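(* Let $\alpha,\beta$ be real numbers with $\alpha>0$ such that $1/\alpha$ is of finite Diophantine type. Then \[ \int_0^1\Bigl|\sum_{\substack{1\leq n\leq N\\ n\in\mathscr B(\alpha,\beta)}}e(n\theta)\Bigr|\,d\theta\ll\log^2(2N), \] and for every $p>1$, \[ \int_0^1\Bigl|\sum_{\substack{1\leq n\leq N\\ n\in\mathscr B(\alpha,\beta)}}e(n\theta)\Bigr|^p\,d\theta\ll N^{p-1}. \] Consequently $\mathscr B(\alpha,\beta)$ is a weakly subconvex $L^1$-set, and for every $p$ with $1<p<2$ it is a strongly subconvex $L^p$-set.
   Context: $e(z)=e^{2\pi i z}$. The Beatty set is $\mathscr B(\alpha,\beta)=\{n\in\mathbb N: n=\lfloor\alpha m+\beta\rfloor\text{ for some }m\in\mathbb N\}$. A real number $\theta$ is of finite Diophantine type if there is $k\in\mathbb N$ with $\liminf_{q\to\infty}q^k\|q\theta\|>0$, where $\|x\|$ is the distance from $x$ to the nearest integer. For $\mathscr A\subseteq\mathbb N$ write $\mathscr A(N)=\mathscr A\cap[1,N]$, $A(N)=\mathrm{card}(\mathscr A(N))$, and $I_p(N;\mathscr A)=\int_0^1|\sum_{n\in\mathscr A(N)}e(n\alpha)|^p\,d\alpha$. A non-empty $\mathscr A\subseteq\mathbb N$ is a weakly subconvex $L^p$-set if $0<p<2$ and for every $\varepsilon>0$ and all $N$ large in terms of $p,\varepsilon$, $I_p(N;\mathscr A)\ll N^{\varepsilon-1}A(N)^p$; it is a strongly subconvex $L^p$-set if $0<p<2$ and for all $N$ large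 in terms of $p$, $I_p(N;\mathscr A)\ll N^{-1}A(N)^p$. Implied constants in the displayed bounds may depend on $\alpha,\beta,p$ but not on $N$. *)

(* Defs.v *)
From mathcomp Require Import all_boot all_order all_algebra.
From mathcomp Require Import all_classical all_reals all_analysis.
From mathcomp Require Import complex.
Set Implicit Arguments.
Unset Strict Implicit.
Unset Printing Implicit Defensive.
Import Order.TTheory GRing.Theory Num.Theory.
Import numFieldNormedType.Exports.
Local Open Scope classical_set_scope.
Local Open Scope ring_scope.

Definition expi (R : realType) (x : R) : R[i] :=
  (cos (2 * pi * x) +i* sin (2 * pi * x))%C.

(* Both n and m range over the positive integers, whence the
   conditions [0 < n] and [0 < m]. *)
Definition beatty (R : realType) (alpha beta : R) : set nat :=
  [set n | (0 < n)%N /\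
     exists2 m : nat, (0 < m)%N & n%:Z = Num.floor (alpha * m%:R + beta)].

Definition dist_int (R : realType) (x : R) : R :=
  inf [set `|x - n%:~R| | n in [set: int]].

(* The lower limit is taken in the extended reals, because the sequence may be
   unbounded. *)
Definition finite_diophantine_type (R : realType) (theta : R) : Prop :=
  exists2 k : nat, (0 < k)%N &
    (0 < limn_einf (fun q : nat =>
           (q%:R ^+ k * dist_int (q%:R * theta))%:E))%E.

(* The elements of A in [1, N], listed in increasing order. *)
Definition upto (A : set nat) (N : nat) : seq nat :=
  [seq n <- index_iota 1 N.+1 | n \in A].

Definition expsum (R : realType) (A : set nat) (N : nat) (theta : R) : R[i] :=
  \sum_(n <- upto A N) expi (n%:R * theta).

Definition moment (R : realType) (p : R) (N : nat) (A : set nat) : R :=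
  \int[lebesgue_measure]_(theta in `[0, 1])
     (ComplexField.Normc.normc (expsum A N theta) `^ p).

(* The implied constant may depend on A and p, but neither on eps nor on N. *)
Definition weakly_subconvex (R : realType) (p : R) (A : set nat) : Prop :=
  [/\ A !=set0, A `<=` [set n | (0 < n)%N], 0 < p < 2 &
    exists2 C : R, 0 < C & forall eps : R, 0 < eps ->
      exists N0 : nat, forall N : nat, (0 < N)%N -> (N0 <= N)%N ->
        moment p N A <= C * (N%:R `^ (eps - 1) * (size (upto A N))%:R `^ p)].

Definition strongly_subconvex (R : realType) (p : R) (A : set nat) : Prop :=
  [/\ A !=set0, A `<=` [set n | (0 < n)%N], 0 < p < 2 &
    exists2 C : R, 0 < C &
      exists N0 : nat, forall N : nat, (0 < N)%N -> (N0 <= N)%N ->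
        moment p N A <= C * (N%:R^-1 * (size (upto A N))%:R `^ p)].

(* Main.v *)
Require Import Defs.
From mathcomp Require Import all_boot all_order all_algebra.
From mathcomp Require Import all_classical all_reals all_analysis.
From mathcomp Require Import complex.
From mathcomp Require Import measurable_realfun.
From mathcomp Require Import zify ring lra.
Set Implicit Arguments.
Unset Strict Implicit.
Unset Printing Implicit Defensive.
Import Order.TTheory GRing.Theory Num.Theory.
Import numFieldNormedType.Exports.
Import ComplexField.
Local Open Scope classical_set_scope.
Local Open Scope ring_scope.

(* Write [gamma = 1 / alpha].  Up to boundedly many exceptions, [n] lies in the
   Beatty set iff the point [b - a n] of the cyclic group Z/Q lies in an arc of
   length [a + 1], where [a / Q] approximates [gamma] and [Q] is a power of [N].
   Both this arc and the interval [1, N] are telescoped into tents (convolutions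
   of two intervals) of dyadic sizes, so that the exponential sum becomes a
   combination of O(log^2 N) pieces, each a tent in [n] times a tent in Z/Q.
   Each piece is an average over Z/Q of products of two exponential sums, so
   AM-GM and Parseval bound its [L^1] norm by an absolute constant: this is the
   log^2 bound.  By Parseval its squared [L^2] norm is at most the number of
   visits to an arc; the Diophantine type of [gamma] separates these visits, so
   that this number decays geometrically in both dyadic scales.  Interpolating
   each piece between [L^1] and [L^2], the pieces add up to [N^(p-1)] without
   loss of logarithms. *)

(** A tent is a sum of products of translated indicators, so AM-GM reduces its [L^1] norm to [L^2]
    norms, whereas a sharp cutoff costs a logarithm. In Z/Q, unlike on the circle, averaging over
    translates is a finite sum and arcs have integer lengths. The exponent is dictated by the type:
    if [k] is the Diophantine exponent, then [Q = 2 ^ ((k + 1) * (I + 1))] with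
    [2 ^ I <= N < 2 ^ (I + 1)]. Rounding [gamma * Q] to [a] displaces the first [N] points by at
    most about [N], so only points within about [N] of an end of the arc are misclassified. Two
    visits, [d] steps apart, to an arc of length [W] satisfy [c * Q <= d ^ k * (d + W)]. For [W] of
    order [N] this forces [d] to be of order [N], which leaves boundedly many exceptions; for
    general [W] it yields the decay in the scale of the arc. When [alpha < 1] the Beatty set
    contains every large integer and the model is the one-point group; [alpha = 1] contradicts the
    type. For [p > 2] Parseval and the trivial bound [N] suffice. *)

Section UnitInterval.
Context {R : realType}.
Implicit Types (f g : R -> R) (F G : R -> R[i]).

Definition int01 f : R := \int[lebesgue_measure]_(theta in `[0, 1]) f theta.

Lemma continuous_integrable01 f : continuous f ->
  (@lebesgue_measure R).-integrable `[0, 1] (EFin \o f).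
Proof.
move=> cf; apply: continuous_compact_integrable; first exact: segment_compact.
exact: continuous_subspaceT.
Qed.

Lemma measurable01 : measurable (`[0, 1]%classic : set R).
Proof. exact: measurable_itv. Qed.
#[local] Hint Resolve measurable01 : core.

Lemma int01_cst (c : R) : int01 (fun=> c) = c.
Proof.
rewrite /int01 Rintegral_cst//= lebesgue_measure_itv.
by rewrite /= lte_fin ltr01 /= subr0 mulr1.
Qed.

Lemma int01_le f g : continuous f -> continuous g ->
  (forall x, f x <= g x) -> int01 f <= int01 g.
Proof.
by move=> cf cg fg; apply: le_Rintegral => //; exact: continuous_integrable01.
Qed.

Lemma int01D f g : continuous f -> continuous g ->
  int01 (fun x => f x + g x) = int01 f + int01 g.
Proof. by move=> cf cg; apply: RintegralD => //; exact: continuous_integrable01. Qed.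

Lemma int01Z f (c : R) : continuous f -> int01 (fun x => c * f x) = c * int01 f.
Proof. by move=> cf; apply: RintegralZl => //; exact: continuous_integrable01. Qed.

Lemma continuous_sumf (T : Type) (s : seq T) (P : pred T) (f : T -> R -> R) :
  (forall t, continuous (f t)) -> continuous (fun x => \sum_(t <- s | P t) f t x).
Proof.
move=> cf; elim: s => [|t s IH] x.
  by under eq_fun do rewrite big_nil; exact: cst_continuous.
under eq_fun do rewrite big_cons.
case: (P t); last exact: IH.
by apply: (@continuousD _ _ _ (f t)); [exact: cf|exact: IH].
Qed.

Lemma int01_sum (T : Type) (s : seq T) (P : pred T) (f : T -> R -> R) :
  (forall t, continuous (f t)) ->
  int01 (fun x => \sum_(t <- s | P t) f t x) = \sum_(t <- s | P t) int01 (f t).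
Proof.
move=> cf; elim: s => [|t s IH].
  by under eq_fun do rewrite big_nil; rewrite int01_cst big_nil.
under eq_fun do rewrite big_cons.
rewrite big_cons -IH; case: (P t) => //.
by rewrite -int01D//; exact: continuous_sumf.
Qed.

Lemma continuous_mulf f g : continuous f -> continuous g ->
  continuous (fun x => f x * g x).
Proof. by move=> cf cg x; apply: (@continuousM _ _ f g); [exact: cf|exact: cg]. Qed.

Lemma continuous_addf f g : continuous f -> continuous g ->
  continuous (fun x => f x + g x).
Proof. by move=> cf cg x; apply: (@continuousD _ _ _ f g); [exact: cf|exact: cg]. Qed.

Lemma continuous_scalef (c : R) f : continuous f ->
  continuous (fun x => c * f x).
Proof. by apply: continuous_mulf => x; exact: cst_continuous. Qed.

Lemma continuous_linear (c : R) : continuous (fun x : R => c * x).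
Proof. by apply: (@continuous_scalef c id) => x; exact: cvg_id. Qed.

Definition ccontinuous F := continuous (fun x => complex.Re (F x)) /\
  continuous (fun x => complex.Im (F x)).

Lemma ccontinuous_cst (c : R[i]) : ccontinuous (fun=> c).
Proof. by split; exact: cst_continuous. Qed.

Lemma ccontinuousD F G : ccontinuous F -> ccontinuous G ->
  ccontinuous (fun x => F x + G x).
Proof.
move=> [F1 F2] [G1 G2]; split=> x.
- under eq_fun do rewrite raddfD /=.
  by apply: continuousD; [exact: F1|exact: G1].
- under eq_fun do rewrite raddfD /=.
  by apply: continuousD; [exact: F2|exact: G2].
Qed.

Lemma ccontinuousM F G : ccontinuous F -> ccontinuous G ->
  ccontinuous (fun x => F x * G x).
Proof.
move=> [F1 F2] [G1 G2]; split=> x.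
- rewrite (_ : (fun _ => _) = (fun x => complex.Re (F x) * complex.Re (G x) -
    complex.Im (F x) * complex.Im (G x))); last first.
    by apply/funext => y; case: (F y) => a b; case: (G y).
  by apply: (@continuousB _ _ _ (fun x => complex.Re (F x) * complex.Re (G x))
    (fun x => complex.Im (F x) * complex.Im (G x))); apply: continuousM;
    first [exact: F1|exact: G1|exact: F2|exact: G2].
- rewrite (_ : (fun _ => _) = (fun x => complex.Re (F x) * complex.Im (G x) +
    complex.Im (F x) * complex.Re (G x))); last first.
    by apply/funext => y; case: (F y) => a b; case: (G y).
  by apply: (@continuousD _ _ _ (fun x => complex.Re (F x) * complex.Im (G x))
    (fun x => complex.Im (F x) * complex.Re (G x))); apply: continuousM;
    first [exact: F1|exact: G1|exact: F2|exact: G2].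
Qed.

Lemma ccontinuous_sum (T : Type) (s : seq T) (P : pred T) (F : T -> R -> R[i]) :
  (forall t, ccontinuous (F t)) -> ccontinuous (fun x => \sum_(t <- s | P t) F t x).
Proof.
move=> cF; elim: s => [|t s IH].
  by under eq_fun do rewrite big_nil; exact: ccontinuous_cst.
under eq_fun do rewrite big_cons.
by case: (P t) => //; exact: ccontinuousD.
Qed.

Lemma ccontinuous_expi n : ccontinuous (fun x : R => expi (n%:R * x)).
Proof.
have H : continuous (fun x : R => 2 * pi * (n%:R * x)).
  by apply: continuous_scalef; exact: continuous_linear.
split=> x.
- by apply: (@continuous_comp _ _ _ (fun x : R => 2 * pi * (n%:R * x)) (@cos R) x); [exact: H|exact: continuous_cos].
- by apply: (@continuous_comp _ _ _ (fun x : R => 2 * pi * (n%:R * x)) (@sin R) x); [exact: H|exact: continuous_sin].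
Qed.

Lemma normc_sqrE (z : R[i]) : Normc.normc z ^+ 2 = complex.Re z ^+ 2 + complex.Im z ^+ 2.
Proof. by case: z => a b /=; rewrite sqr_sqrtr// addr_ge0 ?sqr_ge0. Qed.

Lemma normc_ge0 (z : R[i]) : 0 <= Normc.normc z.
Proof. by case: z => a b; exact: sqrtr_ge0. Qed.

Lemma ccontinuous_normc F : ccontinuous F ->
  continuous (fun x => Normc.normc (F x)).
Proof.
move=> [F1 F2] x.
rewrite (_ : (fun _ => _) = (fun x => Num.sqrt (complex.Re (F x) * complex.Re (F x) +
    complex.Im (F x) * complex.Im (F x)))); last first.
  by apply/funext => y; case: (F y) => a b; rewrite /= !expr2.
apply: continuous_comp; last exact: sqrt_continuous.
apply: (@continuous_addf (fun x => complex.Re (F x) * complex.Re (F x))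
  (fun x => complex.Im (F x) * complex.Im (F x))); exact: continuous_mulf.
Qed.

Lemma normc_sum (T : Type) (s : seq T) (P : pred T) (z : T -> R[i]) :
  Normc.normc (\sum_(t <- s | P t) z t) <= \sum_(t <- s | P t) Normc.normc (z t).
Proof.
elim: s => [|t s IH]; first by rewrite !big_nil Normc.normc0.
rewrite !big_cons; case: (P t) => //.
by apply: le_trans (le_normcD _ _) _; rewrite lerD2l.
Qed.

Lemma normc_real (c : R) : Normc.normc c%:C%C = `|c|.
Proof. by rewrite /= expr0n/= addr0 sqrtr_sqr. Qed.

Lemma normc_expi (x : R) : Normc.normc (expi x) = 1.
Proof. by rewrite /= cos2Dsin2 sqrtr1. Qed.

Lemma expiD (x y : R) : expi (x + y) = expi x * expi y.
Proof.
rewrite /expi mulrDr cosD sinD; apply/eqP; rewrite eq_complex /=.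
by rewrite eqxx /= addrC; apply/eqP; congr (_ + _); rewrite mulrC.
Qed.

Lemma int01_cos (d : R) (n : nat) : (0 < n)%N -> `|d| = n%:R ->
  int01 (fun x => cos (2 * pi * d * x)) = 0.
Proof.
move=> n0 dn.
have d0 : 2 * pi * d != 0.
  have d1 : d != 0 by rewrite -normr_eq0 dn pnatr_eq0 -lt0n.
  by rewrite !mulf_neq0 ?pnatr_eq0// gt_eqF ?pi_gt0.
pose F (x : R) := (2 * pi * d)^-1 * sin (2 * pi * d * x).
have dF (x : R) : is_derive x 1 F (cos (2 * pi * d * x)).
  rewrite /F.
  have H : is_derive x 1 (fun x : R => sin (2 * pi * d * x)) ((2 * pi * d) * cos (2 * pi * d * x)).
    have := @is_derive1_comp _ (@sin R) (fun x => 2 * pi * d * x) x _ (2 * pi * d) (is_derive_sin _).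
    move=> H; rewrite [X in is_derive _ _ _ X]mulrC; apply: H.
    have := @is_deriveZ _ _ _ (@id R) (2 * pi * d) x 1 1 (is_derive_id _ _).
    by rewrite /GRing.scale /= mulr1.
  by apply: (is_derive_eq (is_deriveZ _ H)); rewrite scalerA mulVf// scale1r.
have ccos : continuous (fun x : R => cos (2 * pi * d * x)).
  move=> x; apply: (@continuous_comp _ _ _ (fun x : R => 2 * pi * d * x) (@cos R) x).
    exact: continuous_linear.
  exact: continuous_cos.
have cF : continuous F.
  by move=> x; apply/differentiable_continuous/derivable1_diffP; exact: (@ex_derive _ _ _ _ _ _ _ (dF x)).
rewrite /int01 /Rintegral (@continuous_FTC2 _ _ F) ?ltr01//.
- rewrite /= /F !mulr0 sin0 !mulr1 mulr0 subr0.
  suff -> : sin (2 * pi * d) = 0 by rewrite mulr0.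
  have H : sin (2 * pi * n%:R) = 0 :> R.
    elim: (n) => [|k IH]; first by rewrite mulr0 sin0.
    rewrite -[k.+1]addn1 natrD mulrDr mulr1 sinD IH mul0r add0r.
    by rewrite mulr_natl mulr2n sinDpi sinpi oppr0 mulr0.
  case: (leP 0 d) dn => hd; first by rewrite ger0_norm// => ->.
  by rewrite ltr0_norm// => nd; rewrite -[d]opprK nd mulrN sinN H oppr0.
- exact: continuous_subspaceT.
- split; first by move=> x _; exact: (@ex_derive _ _ _ _ _ _ _ (dF x)).
  + exact/cvg_at_right_filter/cF.
  + exact/cvg_at_left_filter/cF.
- by move=> x _; rewrite derive1E; exact: derive_val.
Qed.
End UnitInterval.

(** * Parseval, convexity and interpolation between [L^1] and [L^2] *)

Section Moments.
Context {R : realType}.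

Definition trigsum (a : nat -> R) (M : nat) (theta : R) : R[i] :=
  \sum_(n < M) (a n)%:C%C * expi (n%:R * theta).

Lemma ccontinuous_trigsum a M : ccontinuous (trigsum a M).
Proof.
apply: ccontinuous_sum => n; apply: ccontinuousM; first exact: ccontinuous_cst.
exact: ccontinuous_expi.
Qed.

Lemma sqr_normc_trigsum a M (x : R) : Normc.normc (trigsum a M x) ^+ 2 =
  \sum_(n < M) \sum_(m < M) a n * a m * cos (2 * pi * (n%:R - m%:R) * x).
Proof.
rewrite normc_sqrE /trigsum !raddf_sum /=.
under eq_bigr do rewrite mul0r subr0.
under [X in _ + X ^+ 2]eq_bigr do rewrite mul0r addr0.
rewrite !expr2 !big_distrlr /= -big_split /=; apply: eq_bigr => n _.
rewrite -big_split /=; apply: eq_bigr => m _.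
rewrite [2 * pi * _ * x](_ : _ = 2 * pi * (n%:R * x) - 2 * pi * (m%:R * x)); last by ring.
by rewrite cosB; ring.
Qed.

Lemma parseval a M :
  int01 (fun x => Normc.normc (trigsum a M x) ^+ 2) = \sum_(n < M) a n ^+ 2.
Proof.
under eq_fun do rewrite sqr_normc_trigsum.
have ccos (d : R) : continuous (fun x : R => cos (2 * pi * d * x)).
  move=> x; apply: (@continuous_comp _ _ _ (fun x : R => 2 * pi * d * x) (@cos R) x).
    exact: continuous_linear.
  exact: continuous_cos.
rewrite int01_sum; last by move=> n; apply: continuous_sumf => m; exact: continuous_scalef.
apply: eq_bigr => n _; rewrite int01_sum; last by move=> m; exact: continuous_scalef.
rewrite (bigD1 n)//= big1 => [|m mn].
  rewrite int01Z// subrr mulr0; under eq_fun do rewrite mul0r cos0.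
  by rewrite int01_cst mulr1 addr0 expr2.
rewrite int01Z//; have [lt_nm|lt_mn|eq_nm] := ltngtP n m.
- rewrite (@int01_cos _ _ (m - n)) ?mulr0 ?subn_gt0//.
  by rewrite distrC natrB 1?ltnW// ger0_norm// subr_ge0 ler_nat ltnW.
- rewrite (@int01_cos _ _ (n - m)) ?mulr0 ?subn_gt0//.
  by rewrite natrB 1?ltnW// ger0_norm// subr_ge0 ler_nat ltnW.
- by move: mn; rewrite (ord_inj eq_nm) eqxx.
Qed.

Lemma powRD_gt0 (x r s : R) : 0 < x -> x `^ (r + s) = x `^ r * x `^ s.
Proof. by move=> x0; rewrite powRD// (gt_eqF x0) implybT. Qed.

(** Young's inequality for [y] and [x ^ (p - 1)] with exponents [p] and [p / (p - 1)];
    geometrically, the graph of the [p]-th power lies above its tangent at [x]. *)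
Lemma powR_tangent (p x y : R) : 1 < p -> 0 <= x -> 0 <= y ->
  p * x `^ (p - 1) * y <= y `^ p + (p - 1) * x `^ p.
Proof.
move=> p1 x0 y0; have p0 : 0 < p by rewrite (lt_trans _ p1).
have pB : 0 < p - 1 by rewrite subr_gt0.
have := @conjugate_powR R y (x `^ (p - 1)) p (p / (p - 1)) y0 (powR_ge0 _ _) p0.
rewrite divr_gt0// => /(_ isT); rewrite -powRrM mulrCA divff ?gt_eqF// mulr1 => H.
have {}H : y * x `^ (p - 1) <= y `^ p / p + x `^ p / (p / (p - 1)).
  by apply: H; field; rewrite !gt_eqF.
rewrite (_ : p * _ * y = p * (y * x `^ (p - 1))); last by ring.
apply: le_trans (ler_wpM2l (ltW p0) H) _.
by rewrite le_eqVlt; apply/orP; left; apply/eqP; field; rewrite !gt_eqF.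
Qed.

(** Jensen's inequality for the values [x k / r k] with weights [r k]: the tangent inequalities at
    the weighted mean [X] are summed. Summable weights keep the number of terms out of the bound. *)
Lemma powR_sum_le (T : finType) (x r : T -> R) (p : R) : 1 < p ->
  (forall k, 0 <= x k) -> (forall k, 0 < r k) ->
  (\sum_k x k) `^ p <=
  (\sum_k r k) `^ (p - 1) * \sum_k r k `^ (1 - p) * x k `^ p.
Proof.
move=> p1 x0 r0; have p0 : 0 < p by rewrite (lt_trans _ p1).
set Z := \sum_k r k; set S := \sum_k x k.
have S0 : 0 <= S by apply: sumr_ge0 => k _.
have [Z0|Zn] := eqVneq Z 0.
  suff -> : S = 0.
    rewrite powR0 ?gt_eqF// mulr_ge0 ?powR_ge0// sumr_ge0// => k _.
    by rewrite mulr_ge0// powR_ge0.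
  apply: big1 => k _; exfalso; move/eqP: Z0.
  by rewrite /Z psumr_eq0 => [/allP/(_ k)|i _]; rewrite ?mem_index_enum ?gt_eqF ?ltW// => /(_ isT).
have Z0 : 0 < Z by rewrite lt_def Zn sumr_ge0// => k _; exact: ltW.
pose X := S / Z; have X0 : 0 <= X by rewrite divr_ge0// ltW.
have key : p * X `^ (p - 1) * (X * Z) <=
    \sum_k r k `^ (1 - p) * x k `^ p + (p - 1) * X `^ p * Z.
  rewrite [X * Z]divfK ?gt_eqF// [in leRHS]/Z /S !mulr_sumr -big_split /=.
  apply: ler_sum => k _.
  have rk := r0 k.
  have := ler_wpM2l (ltW rk) (powR_tangent p1 X0 (divr_ge0 (x0 k) (ltW rk))).
  rewrite [X in X <= _ -> _](_ : _ = p * X `^ (p - 1) * x k); last first.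
    by field; rewrite gt_eqF.
  move=> /le_trans; apply; rewrite mulrDr lerD//; last by rewrite mulrC.
  rewrite powRM ?invr_ge0 ?(ltW rk)// -powR_inv1 ?(ltW rk)// -powRrM mulN1r.
  rewrite mulrCA mulrC ler_wpM2r ?powR_ge0// -{1}[r k]powRr1 ?(ltW rk)//.
  by rewrite -powRD_gt0.
have {}key : X `^ p * Z <= \sum_k r k `^ (1 - p) * x k `^ p.
  move: key; rewrite mulrA -(mulrA p) (mulrC (X `^ (p - 1)) X) mulr_powRB1//.
  by rewrite -lerBlDr; apply: le_trans; rewrite -mulrBl -mulrBl opprB addrC subrK mul1r.
have -> : S `^ p = Z `^ (p - 1) * (X `^ p * Z).
  rewrite [RHS]mulrCA (mulrC (Z `^ _)) mulr_powRB1 ?ltW// -powRM// ?ltW//.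
  by rewrite /X divfK// gt_eqF.
by rewrite ler_wpM2l ?powR_ge0.
Qed.

(** The first term suffices when [x <= A], the second when [x > A]. This pointwise form of
    interpolation leaves the height [A] free. *)
Lemma powR_le_interp (p A x : R) : 1 <= p <= 2 -> 0 < A -> 0 <= x ->
  x `^ p <= A `^ (p - 1) * x + A `^ (p - 2) * x ^+ 2.
Proof.
move=> /andP[p1 p2] A0 x0.
have p0 : 0 < p by rewrite (lt_le_trans _ p1).
have [xA|xA] := leP x A.
  rewrite -[leLHS]addr0 lerD ?mulr_ge0 ?powR_ge0 ?sqr_ge0//.
  rewrite -mulr_powRB1// mulrC ler_wpM2r//.
  by rewrite ge0_ler_powR ?nnegrE ?subr_ge0// ltW.
have x1 : 0 < x by rewrite (lt_trans A0).
rewrite -[leLHS]add0r lerD ?mulr_ge0 ?powR_ge0//.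
have -> : x `^ p = x `^ (p - 2) * x ^+ 2.
  by rewrite -powR_mulrn// -powRD_gt0// subrK.
rewrite ler_wpM2r ?sqr_ge0// -[p - 2]opprB !powRN lef_pV2 ?posrE ?powR_gt0//.
by rewrite ge0_ler_powR ?nnegrE ?subr_ge0// ltW.
Qed.

(** Real powers enter only as measurable functions; the continuous majorant supplies their
    integrability. *)
Lemma int01_le_dominated (f g : R -> R) : measurable_fun setT f -> continuous g ->
  (forall x, 0 <= f x <= g x) -> int01 f <= int01 g.
Proof.
move=> mf cg fg; have ig := continuous_integrable01 cg.
apply: le_Rintegral => //.
- apply: (le_integrable _ _ _ ig) => //.
    by apply/measurable_EFinP; exact: measurable_funTS.
  move=> x _; rewrite /= lee_fin; have /andP[f0 fgx] := fg x.
  by rewrite !ger0_norm// (le_trans f0).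
- by move=> x _; case/andP: (fg x).
Qed.

Lemma measurable_continuous_powR (F : R -> R) (p : R) : continuous F ->
  measurable_fun setT (fun x => F x `^ p).
Proof.
move=> cF; apply: (measurableT_comp (measurable_powR p)).
exact: continuous_measurable_fun.
Qed.

(* Each piece is interpolated between [L^1] and [L^2] at the height [M r_k^2]. *)
Lemma int01_powR_le (T : finType) (x : T -> R -> R) (r : T -> R) (F : R -> R)
    (p D M Z W : R) : 1 < p <= 2 -> 0 <= D -> 0 < M ->
  (forall k, continuous (x k)) -> (forall k y, 0 <= x k y) -> (forall k, 0 < r k) ->
  continuous F -> (forall y, 0 <= F y <= \sum_k x k y) ->
  (forall k, int01 (x k) <= D) ->
  (forall k, int01 (fun y => x k y ^+ 2) <= D * M * r k ^+ 2) ->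
  \sum_k r k <= Z -> \sum_k r k `^ (p - 1) <= W ->
  int01 (fun y => F y `^ p) <= 2 * D * Z `^ (p - 1) * W * M `^ (p - 1).
Proof.
move=> /andP[p1 p2] D0 M0 cx x0 r0 cF Fx xD xM rZ rW.
have p0 : 0 < p by rewrite (lt_trans _ p1).
pose A k := M * r k ^+ 2.
have A0 k : 0 < A k by rewrite mulr_gt0// exprn_gt0.
pose G k y := A k `^ (p - 1) * x k y + A k `^ (p - 2) * x k y ^+ 2.
have cx2 k : continuous (fun y => x k y ^+ 2).
  by rewrite (_ : (fun _ => _) = (fun y => x k y * x k y))//; exact: continuous_mulf.
have cG k : continuous (G k) by apply: continuous_addf; exact: continuous_scalef.
pose H y := (\sum_k r k) `^ (p - 1) * \sum_k r k `^ (1 - p) * G k y.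
have cH : continuous H.
  apply: continuous_scalef; apply: continuous_sumf => k; exact: continuous_scalef.
have FH y : 0 <= F y `^ p <= H y.
  rewrite powR_ge0 /=; have /andP[F0 Fle] := Fx y.
  apply: le_trans (_ : (\sum_k x k y) `^ p <= _).
    by rewrite ge0_ler_powR ?nnegrE ?sumr_ge0// ltW.
  apply: le_trans (powR_sum_le p1 (x0^~ y) r0) _.
  rewrite ler_wpM2l ?powR_ge0// ler_sum// => k _.
  by rewrite ler_wpM2l ?powR_ge0// powR_le_interp// p2 ltW.
apply: le_trans (int01_le_dominated (measurable_continuous_powR _ cF) cH FH) _.
(* The height is chosen to balance the two terms: the [L^2] bound is exactly [D * A k], so both
   contribute [D * A k ^ (p - 1)]. *)
have IG k : int01 (G k) <= 2 * D * A k `^ (p - 1).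
  rewrite int01D; try exact: continuous_scalef.
  rewrite !int01Z// -mulrA mulr_natl mulr2n lerD//.
    by rewrite mulrC ler_wpM2r ?powR_ge0.
  apply: le_trans (ler_wpM2l (powR_ge0 _ _) (xM k)) _.
  rewrite -mulrA -/(A k) (_ : A k `^ (p - 1) = A k `^ (p - 2) * A k).
    by rewrite mulrCA.
  have -> : p - 1 = p - 2 + 1 by ring.
  by rewrite (@powRD_gt0 _ (p - 2) 1)// powRr1 ?(ltW (A0 k)).
rewrite int01Z; last by apply: continuous_sumf => k; exact: continuous_scalef.
rewrite int01_sum; last by move=> k; exact: continuous_scalef.
have rG k : int01 (fun y => r k `^ (1 - p) * G k y) = r k `^ (1 - p) * int01 (G k).
  exact: (int01Z (r k `^ (1 - p)) (cG k)).
rewrite [X in _ * X](eq_bigr (fun k => r k `^ (1 - p) * int01 (G k))); last by move=> k _; exact: rG.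
have Z0 : 0 <= Z by apply: le_trans rZ; rewrite sumr_ge0// => k _; exact: ltW.
(* [A k ^ (p - 1)] carries [r k ^ (2 (p - 1))], which outweighs the Jensen factor [r k ^ (1 - p)]
   and leaves the summable [r k ^ (p - 1)]. *)
have step : \sum_k r k `^ (1 - p) * int01 (G k) <= 2 * D * W * M `^ (p - 1).
  apply: le_trans (_ : \sum_k (2 * D * M `^ (p - 1)) * r k `^ (p - 1) <= _).
    apply: ler_sum => k _.
    apply: le_trans (ler_wpM2l (powR_ge0 _ _) (IG k)) _.
    have rk0 := ltW (r0 k).
    rewrite /A powRM ?sqr_ge0 ?(ltW M0)// -powR_mulrn// -powRrM.
    rewrite le_eqVlt; apply/orP; left; apply/eqP.
    rewrite [LHS](_ : _ = 2 * D * M `^ (p - 1) * (r k `^ (1 - p) * r k `^ (2 * (p - 1)))); last by ring.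
    rewrite -powRD_gt0//; congr (_ * _ `^ _); ring.
  rewrite -mulr_sumr [leRHS](_ : _ = 2 * D * M `^ (p - 1) * W); last by ring.
  by rewrite ler_wpM2l// !mulr_ge0 ?powR_ge0.
apply: le_trans (ler_wpM2l (powR_ge0 _ _) step) _.
rewrite [leRHS](_ : _ = Z `^ (p - 1) * (2 * D * W * M `^ (p - 1))); last by ring.
rewrite ler_wpM2r//.
  rewrite !mulr_ge0 ?powR_ge0//; apply: le_trans rW.
  by rewrite sumr_ge0// => *; exact: powR_ge0.
by rewrite ge0_ler_powR ?nnegrE ?sumr_ge0 ?subr_ge0// => *; exact: ltW.
Qed.

End Moments.

(** * Dyadic telescoping of an interval *)

Section Dyadic.
Context {F : numFieldType}.
Implicit Types phi : nat -> F.

(* The indicator of an interval of length [L] is a combination of tents of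
   dyadic widths [2 ^ j], [j < J], at each end ([b] tells which one) and, for
   [j = J], of the convolution of intervals of lengths [2 ^ J] and [L]. *)
Definition dcoef (J j : nat) (b : bool) : F :=
  if j == J then (~~ b)%:R else (-1) ^+ b / 2.

Definition dlen (J L j : nat) : nat := if j == J then L else (2 ^ j)%N.

(** After transposition both sides are the window of length [L + M] from [s], cut once after [L] and
    once after [M]. *)
Lemma window_shift phi (L M s : nat) :
  \sum_(t < L) phi (s + t)%N - \sum_(t < L) phi (s + M + t)%N =
  \sum_(t < M) phi (s + t)%N - \sum_(t < M) phi (s + t + L)%N.
Proof.
have H : \sum_(t < L) phi (s + t)%N + \sum_(t < M) phi (s + t + L)%N =
         \sum_(t < M) phi (s + t)%N + \sum_(t < L) phi (s + M + t)%N.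
  transitivity (\sum_(t < L + M) phi (s + t)%N).
    rewrite big_split_ord /=; congr (_ + _).
    by apply: eq_bigr => t _; congr phi; lia.
  rewrite addnC big_split_ord /=; congr (_ + _).
  by apply: eq_bigr => t _; congr phi; lia.
by apply/eqP; rewrite subr_eq addrAC eq_sym subr_eq H.
Qed.

(** The leading term averages the window over [2 ^ J] translates. Passing to [2 ^ (J + 1)]
    translates costs half the mean difference between the windows at [s] and at [s + 2 ^ J]; by
    [window_shift] this involves only windows of length [2 ^ J] at the two ends. *)
Lemma dyadic_telescope phi (J L : nat) :
  \sum_(n < L) phi n =
  (2 ^+ J)^-1 * (\sum_(s < 2 ^ J) \sum_(t < L) phi (s + t)%N) +
  \sum_(j < J) (2 ^+ j.+1)^-1 * (\sum_(s < 2 ^ j) \sum_(t < 2 ^ j) phi (s + t)%N -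
     \sum_(s < 2 ^ j) \sum_(t < 2 ^ j) phi (s + t + L)%N).
Proof.
elim: J => [|J IH].
  by rewrite big_ord0 addr0 big_ord1 expr0 invr1 mul1r.
rewrite big_ord_recr /= IH [RHS]addrA [RHS]addrAC; congr (_ + _).
have -> : \sum_(s < 2 ^ J.+1) \sum_(t < L) phi (s + t)%N =
    \sum_(s < 2 ^ J) \sum_(t < L) phi (s + t)%N +
    \sum_(s < 2 ^ J) \sum_(t < L) phi (s + 2 ^ J + t)%N.
  rewrite expnS mul2n -addnn big_split_ord /=; congr (_ + _).
  by apply: eq_bigr => s _; apply: eq_bigr => t _; congr phi; lia.
rewrite -[X in _ = _ + _ * X]sumrB.
under [X in _ = _ + _ * X]eq_bigr do rewrite -window_shift.
rewrite sumrB exprS; field.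
by rewrite expf_neq0 // pnatr_eq0.
Qed.

(** The null coefficient at [j = J], [b = true] only serves to make the index set a product. *)
Lemma dyadic_decomposition phi (J L : nat) :
  \sum_(n < L) phi n =
  \sum_(j < J.+1) \sum_(b : bool) dcoef J j b / 2 ^+ j *
    \sum_(s < 2 ^ j) \sum_(t < dlen J L j) phi (s + t + b * L)%N.
Proof.
rewrite (dyadic_telescope phi J L) big_ord_recr /= addrC; congr (_ + _).
  rewrite big_bool /dcoef /dlen eqxx /= !mul0r add0r mul1r; congr (_ * _).
  by under [RHS]eq_bigr do under eq_bigr do rewrite addn0.
apply: eq_bigr => j _; rewrite big_bool /dcoef /dlen /= ltn_eqF//.
rewrite expr1 expr0 mul1n exprS.
under [X in _ = _ + _ * X]eq_bigr do under eq_bigr do rewrite mul0n addn0.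
by field; rewrite expf_neq0 // pnatr_eq0.
Qed.

Lemma dcoef_le1 J j b : `|dcoef J j b| <= 1.
Proof.
rewrite /dcoef; case: eqP => _; first by case: b; rewrite ?normr0 ?normr1.
rewrite normrM normrX normrN1 expr1n mul1r normfV ger0_norm// invf_le1// ler1n//.
Qed.

End Dyadic.

(** * Tents along a rotation of a finite abelian group *)

Section Pieces.
Context {R : realType} {G : finZmodType} (g u : G).
Implicit Types (z w r : G) (A B L W : nat).

Definition in_arc W z : bool := [exists i : 'I_W, z == u *+ i].

(** Counting with multiplicity makes the arc a plain sum over [i], to which the dyadic decomposition
    applies; on free arcs it is the indicator. *)
Definition arc_mult L z : R := \sum_(i < L) (z == u *+ i)%:R.

Definition arc_free L := forall i j, (i < L)%N -> (j < L)%N -> u *+ i = u *+ j -> i = j.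

Lemma arc_free_le L L' : (L <= L')%N -> arc_free L' -> arc_free L.
Proof. by move=> LL' H i j iL jL; apply: H; exact: leq_trans LL'. Qed.

Lemma arc_multE L z : arc_free L -> arc_mult L z = (in_arc L z)%:R.
Proof.
move=> uL; rewrite /arc_mult; case: (boolP (in_arc L z)) => [/existsP[i /eqP zi]|nz].
  rewrite (bigD1 i)//= zi eqxx big1 ?addr0// => j ji.
  case: eqP => // E; move: ji; rewrite -(inj_eq val_inj) /=.
  by rewrite (uL i j)// eqxx.
by apply: big1 => i _; case: eqP => // zi; case/negP: nz; apply/existsP; exists i; apply/eqP.
Qed.

Lemma sum_arc_mult L : \sum_z arc_mult L z = L%:R.
Proof.
rewrite /arc_mult exchange_big /= (eq_bigr (fun=> 1)) => [|i _].
  by rewrite sumr_const card_ord.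
by rewrite (bigD1 (u *+ i))//= eqxx big1 ?addr0// => z /negbTE ->.
Qed.

Definition arc_conv A B z : R :=
  \sum_(s < A) \sum_(t < B) (z == u *+ (s + t))%:R.

Lemma arc_convE A B z : arc_conv A B z = \sum_(s < A) arc_mult B (z - u *+ s).
Proof.
apply: eq_bigr => s _; apply: eq_bigr => t _.
by rewrite mulrnDr subr_eq addrC.
Qed.

Lemma arc_conv_ge0 A B z : 0 <= arc_conv A B z.
Proof. by apply: sumr_ge0 => s _; apply: sumr_ge0. Qed.

Lemma arc_conv_le A B z : arc_free B ->
  arc_conv A B z <= A%:R * (in_arc (A + B) z)%:R.
Proof.
move=> uB; rewrite arc_convE.
apply: le_trans (_ : \sum_(s < A) (in_arc (A + B) z)%:R <= _); last first.
  by rewrite sumr_const card_ord mulr_natl.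
apply: ler_sum => s _.
rewrite arc_multE// ler_nat; case: (boolP (in_arc B _)) => //= /existsP[t /eqP zt].
rewrite lt0b; apply/existsP.
have st : (s + t < A + B)%N by rewrite -addSn leq_add// ltnW.
by exists (Ordinal st); rewrite /= mulrnDr -zt addrC subrK.
Qed.

(* The convolution of two arcs is positive definite up to translation. *)
Lemma arc_conv_split A B z x y :
  arc_conv A B (z + g *+ (x + y)) =
  \sum_r arc_mult A (r + g *+ x) * arc_mult B (z - r + g *+ y).
Proof.
rewrite (reindex_inj (addIr (- (g *+ x)))) /=.
under eq_bigr do rewrite subrK.
rewrite arc_convE; under [RHS]eq_bigr do rewrite mulr_suml.
rewrite [RHS]exchange_big /=; apply: eq_bigr => s _.
rewrite (bigD1 (u *+ s))//= eqxx mul1r big1 ?addr0 => [|r /negbTE ->]; last by rewrite mul0r.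
congr arc_mult; rewrite mulrnDr opprB !addrA.
exact: addrAC.
Qed.

Definition piece A B A' B' z (theta : R) : R[i] :=
  \sum_(s < A) \sum_(t < B)
    (arc_conv A' B' (z + g *+ (s + t)))%:C%C * expi ((s + t)%:R * theta).

Lemma ccontinuous_piece A B A' B' z : ccontinuous (piece A B A' B' z).
Proof.
apply: ccontinuous_sum => s; apply: ccontinuous_sum => t.
by apply: ccontinuousM; [exact: ccontinuous_cst|exact: ccontinuous_expi].
Qed.

(* The sum over [r] is what makes Parseval applicable: each factor is the
   exponential sum over the visits of one orbit to one arc. *)
Lemma piece_factor A B A' B' z theta : piece A B A' B' z theta =
  \sum_r trigsum (fun s => arc_mult A' (r + g *+ s)) A theta *
         trigsum (fun t => arc_mult B' (z - r + g *+ t)) B theta.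
Proof.
under [RHS]eq_bigr do rewrite /trigsum big_distrlr /=.
rewrite exchange_big /=; apply: eq_bigr => s _.
rewrite exchange_big /=; apply: eq_bigr => t _.
rewrite arc_conv_split raddf_sum /= mulr_suml; apply: eq_bigr => r _.
by rewrite rmorphM /= natrD mulrDl expiD mulrACA.
Qed.

(** AM-GM is applied to each product in [piece_factor], then Parseval to each factor. The bound does
    not see the order of [G], since an orbit point lies in an arc of length [A'] for only [A']
    translates [r]. *)
Lemma int01_normc_piece A B A' B' z : arc_free A' -> arc_free B' ->
  int01 (fun x => Normc.normc (piece A B A' B' z x)) <=
  ((A * A')%:R + (B * B')%:R) / 2.
Proof.
move=> uA uB.
pose F r := trigsum (fun s => arc_mult A' (r + g *+ s)) A.
pose H r := trigsum (fun t => arc_mult B' (z - r + g *+ t)) B.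
have cF r : continuous (fun x => Normc.normc (F r x) ^+ 2).
  rewrite (_ : (fun _ => _) = (fun x => Normc.normc (F r x) * Normc.normc (F r x)))//.
  by apply: continuous_mulf; apply: ccontinuous_normc; exact: ccontinuous_trigsum.
have cH r : continuous (fun x => Normc.normc (H r x) ^+ 2).
  rewrite (_ : (fun _ => _) = (fun x => Normc.normc (H r x) * Normc.normc (H r x)))//.
  by apply: continuous_mulf; apply: ccontinuous_normc; exact: ccontinuous_trigsum.
pose K x := \sum_r 2^-1 * (Normc.normc (F r x) ^+ 2 + Normc.normc (H r x) ^+ 2).
have cFH r : continuous (fun x => Normc.normc (F r x) ^+ 2 + Normc.normc (H r x) ^+ 2).
  exact: continuous_addf.
apply: le_trans (_ : int01 K <= _).
  apply: int01_le.
  - by apply: ccontinuous_normc; exact: ccontinuous_piece.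
  - by apply: continuous_sumf => r; exact: continuous_scalef.
  move=> x; rewrite piece_factor; apply: le_trans (normc_sum _ _ _) _.
  apply: ler_sum => r _; rewrite Normc.normcM -/(F r) -/(H r).
  have := sqr_ge0 (Normc.normc (F r x) - Normc.normc (H r x)).
  by rewrite sqrrB; lra.
rewrite int01_sum => [|r]; last exact: continuous_scalef.
under eq_bigr => r _ do rewrite (int01Z _ (cFH r)) (int01D (cF r) (cH r)) !parseval.
rewrite -mulr_sumr mulrC ler_wpM2r ?invr_ge0// big_split /=.
(* For fixed [s] the argument runs once through [G] as [r] does, so the arc is met [Z] times;
   squares are harmless because a free arc has multiplicities 0 and 1. *)
have key (Y : nat) (Z : nat) (v : G -> G) (w : nat -> G) : injective v -> arc_free Z ->
    \sum_r \sum_(s < Y) arc_mult Z (v r + w s) ^+ 2 = (Y * Z)%:R.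
  move=> iv uZ; rewrite exchange_big /= natrM mulr_natl.
  rewrite -[Y in RHS]card_ord -sumr_const; apply: eq_bigr => s _.
  rewrite -(sum_arc_mult Z) [RHS](reindex_inj (inj_comp (addIr (w s)) iv)) /=.
  by apply: eq_bigr => r _; rewrite arc_multE// -natrX; case: in_arc.
by rewrite (key _ _ id) // (key _ _ (fun r => z - r))// => r r' /addrI/oppr_inj.
Qed.

Lemma int01_sqr_piece A B A' B' z : arc_free B' ->
  int01 (fun x => Normc.normc (piece A B A' B' z x) ^+ 2) <=
  (A * A')%:R ^+ 2 * (\sum_(n < A + B) in_arc (A' + B') (z + g *+ n)%R)%:R.
Proof.
move=> uB.
(* Terms with the same frequency [n = s + t] are collected. There are at most [A] of them, as [s]
   determines [t], and the arc tent is at most [A'] on its support. *)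
pose a (n : nat) : R := (\sum_(s < A) \sum_(t < B) (n == (s + t)%N)%:R) *
  arc_conv A' B' (z + g *+ n).
have -> : piece A B A' B' z = trigsum a (A + B).
  apply/funext => x; rewrite /trigsum /a.
  under [RHS]eq_bigr do rewrite rmorphM raddf_sum /= -mulrA mulr_suml.
  rewrite exchange_big /=; apply: eq_bigr => s _.
  under [RHS]eq_bigr do rewrite raddf_sum /= mulr_suml.
  rewrite exchange_big /=; apply: eq_bigr => t _.
  have st : (s + t < A + B)%N by rewrite -addSn leq_add// ltnW.
  rewrite (bigD1 (Ordinal st))//= eqxx mul1r big1 ?addr0// => n.
  by rewrite -(inj_eq val_inj) /= => /negbTE ->; rewrite mul0r.
rewrite parseval natr_sum mulr_sumr; apply: ler_sum => n _.
have -> : (in_arc (A' + B') (z + g *+ n))%:R = (in_arc (A' + B') (z + g *+ n))%:R ^+ 2 :> R.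
  by case: in_arc; rewrite ?expr1n ?expr0n.
rewrite -exprMn ler_pXn2r ?nnegrE ?mulr_ge0 ?arc_conv_ge0//; last first.
  by apply: sumr_ge0 => s _; apply: sumr_ge0.
rewrite natrM -mulrA ler_pM ?arc_conv_ge0 ?arc_conv_le//.
  by apply: sumr_ge0 => s _; apply: sumr_ge0.
rewrite -[A in leRHS]card_ord -sumr_const; apply: ler_sum => s _.
have [[t /eqP nt]|nt] := pselect (exists t : 'I_B, (n : nat) == (s + t)%N).
  rewrite (bigD1 t)//= nt eqxx big1 ?addr0// => t' tt'.
  by rewrite eqn_add2l eq_sym (inj_eq val_inj) (negbTE tt').
by rewrite big1// => t _; case: eqP => // E; case: nt; exists t; apply/eqP.
Qed.

End Pieces.

(** * The model sum as a combination of normalized pieces *)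

Section Decomposition.
Context {R : realType} {G : finZmodType} (g u z : G).
Variables (N l I J : nat).
Hypothesis NI : (2 ^ I <= N <= 2 ^ I.+1)%N.
Hypothesis lJ : (2 ^ J <= l <= 2 ^ J.+1)%N.
Hypothesis ufree : arc_free u l.

Definition pindex : finType := ('I_I.+1 * bool * ('I_J.+1 * bool))%type.

Definition pcoef (k : pindex) : R :=
  (dcoef I k.1.1 k.1.2 / 2 ^+ k.1.1) * (dcoef J k.2.1 k.2.2 / 2 ^+ k.2.1).

Definition npiece (k : pindex) (theta : R) : R[i] :=
  (pcoef k)%:C%C * (expi ((k.1.2 * N)%:R * theta) *
    piece g u (2 ^ k.1.1) (dlen I N k.1.1) (2 ^ k.2.1) (dlen J l k.2.1)
      (z + g *+ (k.1.2 * N) - u *+ (k.2.2 * l)) theta).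

Lemma dcoef_real (K j : nat) (b : bool) : (dcoef K j b : R[i]) = (dcoef K j b : R)%:C%C.
Proof.
rewrite /dcoef; case: eqP => _; first by rewrite rmorph_nat.
by rewrite rmorphM rmorphXn rmorphN1 fmorphV rmorph_nat.
Qed.

Lemma arc_mult_dyadic (w : G) : arc_mult u l w =
  \sum_(j < J.+1) \sum_(b : bool) dcoef J j b / 2 ^+ j *
    arc_conv u (2 ^ j) (dlen J l j) (w - u *+ (b * l)) :> R.
Proof.
rewrite /arc_mult (@dyadic_decomposition R (fun i => (w == u *+ i)%:R) J l).
apply: eq_bigr => j _; apply: eq_bigr => b _; congr (_ * _).
apply: eq_bigr => s _; apply: eq_bigr => t _.
by rewrite [in LHS]mulrnDr subr_eq.
Qed.

(** The interval of [n] is telescoped first, then the arc. A shift of [n] by [N] becomes a phase and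
    a translation by [g *+ N]; a shift along the arc becomes a translation by a multiple of [u]. *)
Lemma model_decomposition (theta : R) :
  \sum_(n < N) (arc_mult u l (z + g *+ n))%:C%C * expi (n%:R * theta) =
  \sum_(k : pindex) npiece k theta.
Proof.
rewrite (@dyadic_decomposition R[i] (fun n =>
  (arc_mult u l (z + g *+ n))%:C%C * expi (n%:R * theta)) I N).
rewrite -(pair_bigA _ (fun ib jb => npiece (ib, jb) theta)) /=.
rewrite -(pair_bigA _ (fun i b => \sum_(jb : 'I_J.+1 * bool) npiece ((i, b), jb) theta)) /=.
apply: eq_bigr => i _; apply: eq_bigr => b _.
rewrite -(pair_bigA _ (fun j b' => npiece ((i, b), (j, b')) theta)) /=.
rewrite dcoef_real /npiece /pcoef /=.
have E2 n : (2 ^+ n)^-1 = ((2 ^+ n)^-1)%:C%C :> R[i] by rewrite fmorphV rmorphXn rmorph_nat.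
rewrite E2 -rmorphM /=.
under [RHS]eq_bigr => j _ do under eq_bigr => b' _ do
  rewrite rmorphM /= -!mulrA.
under [RHS]eq_bigr => j _ do rewrite -mulr_sumr.
rewrite -mulr_sumr; congr (_ * _).
under [RHS]eq_bigr => j _ do under eq_bigr => b' _ do rewrite mulrCA.
under [RHS]eq_bigr => j _ do rewrite -mulr_sumr.
rewrite -mulr_sumr.
under [in RHS]eq_bigr => j _ do under eq_bigr => b' _ do
  rewrite /piece mulr_sumr; under [in RHS]eq_bigr => j _ do rewrite exchange_big /=.
rewrite [in RHS]exchange_big /= mulr_sumr; apply: eq_bigr => s _.
under [in RHS]eq_bigr => j _ do under eq_bigr => b' _ do
  rewrite mulr_sumr; under [in RHS]eq_bigr => j _ do rewrite exchange_big /=.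
rewrite [in RHS]exchange_big /= mulr_sumr; apply: eq_bigr => t _.
rewrite arc_mult_dyadic raddf_sum /= mulr_suml mulr_sumr.
apply: eq_bigr => j _; rewrite raddf_sum /= mulr_suml mulr_sumr.
apply: eq_bigr => b' _; rewrite rmorphM /= natrD mulrDl expiD.
rewrite [in RHS](_ : z + _ - _ + _ = z + g *+ (s + t + b * N) - u *+ (b' * l)); last first.
  rewrite [(s + t + _)%N]addnC [in RHS]mulrnDr addrA; exact: addrAC.
by rewrite mulrA mulrC -!mulrA.
Qed.

Lemma ccontinuous_npiece k : ccontinuous (npiece k).
Proof.
apply: ccontinuousM; first exact: ccontinuous_cst.
apply: ccontinuousM; first exact: ccontinuous_expi.
exact: ccontinuous_piece.
Qed.

Lemma normc_pcoef_le k : `|pcoef k| * (2 ^ k.1.1 * 2 ^ k.2.1)%:R <= 1.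
Proof.
rewrite /pcoef !normrM !normfV !(ger0_norm (exprn_ge0 _ _))//.
rewrite natrM !natrX mulrACA -!mulrA mulVf ?expf_neq0 ?pnatr_eq0// mulr1.
rewrite mulKf ?expf_neq0 ?pnatr_eq0//.
by rewrite mulr_ile1 ?dcoef_le1.
Qed.

Lemma normc_npiece k theta : Normc.normc (npiece k theta) = `|pcoef k| *
  Normc.normc (piece g u (2 ^ k.1.1) (dlen I N k.1.1) (2 ^ k.2.1) (dlen J l k.2.1)
      (z + g *+ (k.1.2 * N) - u *+ (k.2.2 * l)) theta).
Proof. by rewrite !Normc.normcM normc_expi mul1r normc_real. Qed.

Lemma dlen_bounds L K j : (2 ^ K <= L <= 2 ^ K.+1)%N -> (j <= K)%N ->
  (dlen K L j <= 2 * 2 ^ j)%N /\ (dlen K L j <= L)%N /\ (2 ^ j <= L)%N.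
Proof.
move=> /andP[LK LK2] jK; rewrite /dlen.
have j2 : (2 ^ j <= 2 ^ K)%N by rewrite leq_exp2l.
case: eqP => [->|_]; first by rewrite -expnS LK2.
by rewrite mul2n -addnn leq_addr (leq_trans j2).
Qed.

(** The longer side of each tent is at most twice the shorter one, whence [(1 + 2 * 2) / 2] after
    normalization by the product of the shorter sides. *)
Lemma int01_npiece k : int01 (fun x => Normc.normc (npiece k x)) <= 5 / 2.
Proof.
under eq_fun do rewrite normc_npiece.
rewrite int01Z; last by apply: ccontinuous_normc; exact: ccontinuous_piece.
have [i1 [i2 i3]] := dlen_bounds NI (ltn_ord k.1.1).
have [j1 [j2 j3]] := dlen_bounds lJ (ltn_ord k.2.1).
apply: le_trans (ler_wpM2l (normr_ge0 _) (int01_normc_piece _ _ _ _ _ _)) _.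
- exact: arc_free_le ufree.
- exact: arc_free_le ufree.
apply: le_trans (_ : `|pcoef k| * (5 / 2 * (2 ^ k.1.1 * 2 ^ k.2.1)%:R) <= _); last first.
  by rewrite mulrCA -[leRHS]mulr1 ler_wpM2l// normc_pcoef_le.
rewrite ler_wpM2l// [leRHS]mulrAC ler_wpM2r ?invr_ge0//.
rewrite -natrD -natrM ler_nat.
have := leq_mul i1 j1; lia.
Qed.

Lemma arc_le W W' w : (W <= W')%N -> (in_arc u W w <= in_arc u W' w)%N.
Proof.
move=> WW; case: (boolP (in_arc u W w)) => // /existsP[i iw].
by rewrite lt0b; apply/existsP; exists (widen_ord WW i).
Qed.

(** The factor 3 bounds the support of a tent: [2 ^ j] plus a side of length at most [2 * 2 ^ j]. *)
Lemma int01_sqr_npiece (k : pindex) (Q : R) :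
  (forall w, (\sum_(n < 3 * 2 ^ k.1.1) in_arc u (3 * 2 ^ k.2.1) (w + g *+ n)%R)%:R <= Q) ->
  int01 (fun x => Normc.normc (npiece k x) ^+ 2) <= Q.
Proof.
move=> HQ; under eq_fun do rewrite normc_npiece exprMn.
set F := piece _ _ _ _ _ _ _.
have cF : continuous (fun x => Normc.normc (F x)).
  by apply: ccontinuous_normc; exact: ccontinuous_piece.
rewrite int01Z; last by rewrite (_ : (fun _ => _) = (fun x => Normc.normc (F x) * Normc.normc (F x)))//; exact: continuous_mulf.
have [i1 [i2 i3]] := dlen_bounds NI (ltn_ord k.1.1).
have [j1 [j2 j3]] := dlen_bounds lJ (ltn_ord k.2.1).
apply: le_trans (ler_wpM2l (sqr_ge0 _) (int01_sqr_piece _ _ _ _ _ _)) _.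
  exact: arc_free_le ufree.
rewrite mulrA -exprMn -[leRHS]mul1r ler_pM ?sqr_ge0//.
  by rewrite expr_le1// ?normc_pcoef_le// mulr_ge0.
apply: le_trans (HQ (z + g *+ (k.1.2 * N) - u *+ (k.2.2 * l))).
rewrite ler_nat.
have le3 : (2 ^ k.1.1 + dlen I N k.1.1 <= 3 * 2 ^ k.1.1)%N by lia.
have lej3 : (2 ^ k.2.1 + dlen J l k.2.1 <= 3 * 2 ^ k.2.1)%N by lia.
rewrite -!(big_mkord xpredT (fun n => in_arc u _ (_ + g *+ n)%R : nat)) .
rewrite [leqRHS](big_cat_nat (leq0n _) le3) /=.
apply: leq_trans (leq_addr _ _); apply: leq_sum => n _.
exact: (arc_le _ lej3).
Qed.

End Decomposition.

(** * Moment bounds for sets modelled by a rotation *)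

Section Tame.
Context {R : realType}.
Implicit Types (A : set nat) (N K : nat) (D rho q : R).

(* At height [N], the set [A] agrees up to [D] elements with the visits of a
   finite rotation [n |-> z + n g] to an arc, and this rotation visits every
   dyadic arc rarely. *)
Definition tame A K D rho N : Prop :=
  exists (G : finZmodType) (g u z : G) (l I J : nat),
  [/\ (2 ^ I <= N <= 2 ^ I.+1)%N,
      (2 ^ J <= l <= 2 ^ J.+1)%N /\ (J <= K * I.+1)%N,
      arc_free u l,
      forall i j w, (i <= I)%N -> (j <= J)%N ->
        (\sum_(n < 3 * 2 ^ i) in_arc u (3 * 2 ^ j) (w + g *+ n)%R)%:R
          <= D * 2 ^+ I * (rho ^+ ((I - i) + (J - j))) ^+ 2 &
      (\sum_(n < N) ((n.+1 \in A) (+) in_arc u l (z + g *+ n)%R))%:R <= D].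

Lemma expsumE A N (y : R) :
  expsum A N y = \sum_(n < N) (n.+1 \in A)%:R * expi (n.+1%:R * y).
Proof.
rewrite /expsum /upto big_filter big_add1 /= big_mkord big_mkcond /=.
by apply: eq_bigr => n _; case: (_ \in A); rewrite ?mul1r ?mul0r.
Qed.

Lemma ccontinuous_expsum A N : ccontinuous (expsum A N : R -> R[i]).
Proof. by apply: ccontinuous_sum => n; exact: ccontinuous_expi. Qed.

Lemma normc_expsum_le (G : finZmodType) (g u z : G) (l I J : nat) A N (y : R) :
  arc_free u l ->
  Normc.normc (expsum A N y) <=
    \sum_(k : pindex I J) Normc.normc (npiece g u z N l k y) +
    (\sum_(n < N) ((n.+1 \in A) (+) in_arc u l (z + g *+ n)%R))%:R.
Proof.
move=> ufree.
(* The orbit is indexed from [n = 0] but represents [n.+1]; the shift is a unimodular factor. *)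
have -> : expsum A N y = expi y *
    (\sum_(n < N) (arc_mult u l (z + g *+ n))%:C%C * expi (n%:R * y) +
     \sum_(n < N) ((n.+1 \in A)%:R - (in_arc u l (z + g *+ n))%:R) * expi (n%:R * y)).
  rewrite expsumE -big_split mulr_sumr; apply: eq_bigr => n _ /=.
  rewrite arc_multE// rmorph_nat -mulrDl addrC subrK mulrCA -expiD.
  by rewrite -natr1 mulrDl mul1r addrC.
rewrite Normc.normcM normc_expi mul1r (model_decomposition g u z N l I J y).
apply: le_trans (le_normcD _ _) _; apply: lerD; first exact: normc_sum.
apply: le_trans (normc_sum _ _ _) _; rewrite natr_sum; apply: ler_sum => n _.
rewrite Normc.normcM normc_expi mulr1.
rewrite -!(rmorph_nat (real_complex R)) -rmorphB normc_real.
by case: (_ \in A); case: in_arc; rewrite /= ?subrr ?subr0 ?sub0r ?normrN ?normr0 ?normr1.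
Qed.

Lemma geometric_sum_le q (n : nat) : 0 < q < 1 -> \sum_(i < n) q ^+ (n.-1 - i) <= (1 - q)^-1.
Proof.
move=> /andP[q0 q1]; case: n => [|n]; first by rewrite big_ord0 invr_ge0 subr_ge0 ltW.
rewrite (reindex_inj rev_ord_inj) /=.
under eq_bigr => i _ do rewrite subSS subKn ?leq_ord//.
rewrite -[leRHS]mul1r ler_pdivlMr ?subr_gt0// mulrC -[X in X * _]opprB mulNr.
by rewrite -GRing.subrX1 opprB lerBlDr lerDl exprn_ge0// ltW.
Qed.

Lemma pindex_sum_le q (I J : nat) : 0 < q < 1 ->
  \sum_(k : pindex I J) q ^+ ((I - k.1.1) + (J - k.2.1)) <= 4 * (1 - q) ^- 2.
Proof.
move=> q01.
rewrite -(pair_bigA _ (fun (ib : 'I_I.+1 * bool) (jb : 'I_J.+1 * bool) => q ^+ ((I - ib.1) + (J - jb.1)))) /=.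
rewrite -(pair_bigA _ (fun (i : 'I_I.+1) (_ : bool) => \sum_(jb : 'I_J.+1 * bool) q ^+ ((I - i) + (J - jb.1)))) /=.
have -> : \sum_(i < I.+1) \sum_(b : bool) \sum_(jb : 'I_J.+1 * bool) q ^+ ((I - i) + (J - jb.1)) =
    4 * ((\sum_(i < I.+1) q ^+ (I - i)) * \sum_(j < J.+1) q ^+ (J - j)).
  rewrite mulr_suml mulr_sumr; apply: eq_bigr => i _.
  rewrite big_bool /= -(pair_bigA _ (fun (j : 'I_J.+1) (_ : bool) => q ^+ ((I - i) + (J - j)))) /=.
  under eq_bigr => j _ do rewrite big_bool /= exprD.
  rewrite big_split /= -mulr_sumr; ring.
have S n := geometric_sum_le n.+1 q01; rewrite /= in S.
have S0 n : 0 <= \sum_(i < n.+1) q ^+ (n - i).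
  by apply: sumr_ge0 => i _; case/andP: q01 => q0 _; rewrite exprn_ge0// ltW.
rewrite expr2 invfM; apply: ler_wpM2l => //.
by apply: ler_pM; [exact: S0|exact: S0|exact: S|exact: S].
Qed.

Lemma card_pindex (I J : nat) : #|pindex I J| = (4 * (I.+1 * J.+1))%N.
Proof. by rewrite !card_prod card_bool !card_ord; lia. Qed.

Lemma tame_ge0 A K D rho N : tame A K D rho N -> 0 <= D.
Proof. by move=> [G [g [u [z [l [I [J [_ _ _ _]]]]]]]]; apply: le_trans. Qed.

(** There are [4 (I + 1) (J + 1)] pieces of norm at most [5 / 2], with [J + 1 <= (K + 1) (I + 1)];
    and [2 ^ I <= N] gives [(I + 1) ln 2 <= ln (2 N)]. *)
Lemma int01_expsum_tame A K D rho N : (0 < N)%N -> tame A K D rho N ->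
  int01 (fun y => Normc.normc (expsum A N y)) <=
    (10 * K.+1%:R + D) / ln 2 ^+ 2 * ln (2 * N%:R) ^+ 2.
Proof.
move=> N0 tA; have D0 := tame_ge0 tA.
case: tA => G [g [u [z [l [I [J [NI [lJ JI] ufree _ err]]]]]]].
have cont (k : pindex I J) : continuous (fun y : R => Normc.normc (npiece g u z N l k y)).
  by apply: ccontinuous_normc; exact: ccontinuous_npiece.
apply: le_trans (_ : int01 (fun y : R => \sum_(k : pindex I J) Normc.normc (npiece g u z N l k y) + D) <= _).
  apply: int01_le.
  - by apply: ccontinuous_normc; exact: ccontinuous_expsum.
  - apply: continuous_addf; last by move=> ?; exact: cst_continuous.
    exact: continuous_sumf.
  - move=> y; apply: le_trans (normc_expsum_le g z I J A N y ufree) _.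
    by rewrite lerD2l.
rewrite int01D; [|exact: continuous_sumf|by move=> ?; exact: cst_continuous].
rewrite int01_cst int01_sum//.
apply: le_trans (_ : \sum_(k : pindex I J) (5 / 2) + D <= _).
  by rewrite lerD2r; apply: ler_sum => k _; exact: int01_npiece.
rewrite sumr_const card_pindex.
have ln20 : 0 < ln 2 :> R by rewrite ln_gt0// ltr1n.
have lnN : I.+1%:R * ln 2 <= ln (2 * N%:R) :> R.
  rewrite [leLHS]mulr_natl -lnXn// ler_ln ?posrE ?mulr_gt0 ?exprn_gt0 ?ltr0n//.
  rewrite exprS ler_pM2l// -natrX ler_nat.
  by case/andP: NI.
apply: le_trans (_ : (10 * K.+1%:R + D) * I.+1%:R ^+ 2 <= _); last first.
  rewrite -mulrA ler_wpM2l ?addr_ge0 ?mulr_ge0// mulrC ler_pdivlMr ?exprn_gt0//.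
  by rewrite -exprMn ler_pXn2r ?nnegrE ?mulr_ge0 ?(ltW ln20)// (le_trans _ lnN)// mulr_ge0// ltW.
rewrite [leRHS]mulrDl; apply: lerD; last first.
  by rewrite -[leLHS]mulr1 ler_wpM2l// expr_ge1 ?ler1n.
have -> : 5 / 2 *+ (4 * (I.+1 * J.+1)) = 10 * (I.+1 * J.+1)%:R :> R.
  by rewrite -mulr_natr natrM; field.
rewrite -[leRHS]mulrA; apply: ler_wpM2l => //.
rewrite expr2 -!natrM ler_nat mulnC mulnA leq_mul2r /=.
by rewrite mulSn; move: JI; lia.
Qed.

Lemma int01_expsum_powR_tame A K D rho p : 1 < p <= 2 -> 0 < rho < 1 ->
  exists2 C : R, 0 < C & forall N, (0 < N)%N -> tame A K D rho N ->
  int01 (fun y => Normc.normc (expsum A N y) `^ p) <= C * N%:R `^ (p - 1).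
Proof.
move=> p12 rho01; have /andP[p1 p2] := p12; have /andP[rho0 rho1] := rho01.
pose D' := D ^+ 2 + `|D| + 5 / 2.
pose Z := 1 + 4 * (1 - rho) ^- 2.
pose W := 1 + 4 * (1 - rho `^ (p - 1)) ^- 2.
have D'0 : 0 < D' by rewrite ltr_wpDl// ?addr_ge0 ?sqr_ge0// divr_gt0.
have q0 : 0 < rho `^ (p - 1) by rewrite powR_gt0.
have q1 : rho `^ (p - 1) < 1.
  have p10 : 0 < p - 1 by rewrite subr_gt0.
  have := gt0_ltr_powR p10 _ _ rho1; rewrite powR1; apply; rewrite nnegrE//.
  exact: ltW.
have Z0 : 0 < Z by rewrite ltr_pwDl// mulr_ge0// invr_ge0 sqr_ge0.
have W0 : 0 < W by rewrite ltr_pwDl// mulr_ge0// invr_ge0 sqr_ge0.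
exists (2 * D' * Z `^ (p - 1) * W).
  by rewrite !mulr_gt0// powR_gt0.
move=> N N0 tA; have D0 := tame_ge0 tA.
case: tA => G [g [u [z [l [I [J [NI [lJ JI] ufree cnt err]]]]]]].
(* The exceptional elements join the family as one more piece, the index [None], with constant value
   [D] and weight 1. *)
pose x (o : option (pindex I J)) (y : R) :=
  if o is Some k then Normc.normc (npiece g u z N l k y) else D.
pose r (o : option (pindex I J)) : R :=
  if o is Some k then rho ^+ ((I - k.1.1) + (J - k.2.1)) else 1.
have N1 : 1 <= N%:R :> R by rewrite ler1n.
have sum_option (f : option (pindex I J) -> R) :
    \sum_o f o = f None + \sum_k f (Some k).
  rewrite (bigD1 None)//=; congr (_ + _).
  rewrite (reindex_omap Some id) => [|[k|]//].
  by apply: eq_bigl => k; rewrite /= eqxx.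
apply: (@int01_powR_le _ _ x r) => //.
- exact: ltW.
- by rewrite ltr0n.
- move=> [k|]; last by move=> ?; exact: cst_continuous.
  by apply: ccontinuous_normc; exact: ccontinuous_npiece.
- by move=> [k|] y //=; exact: normc_ge0.
- by move=> [k|] //=; rewrite exprn_gt0.
- by apply: ccontinuous_normc; exact: ccontinuous_expsum.
- move=> y; rewrite normc_ge0 /= sum_option addrC.
  apply: le_trans (normc_expsum_le g z I J A N y ufree) _.
  by rewrite lerD2l.
- move=> [k|].
    apply: le_trans (int01_npiece g z NI lJ ufree k) _.
    by rewrite /D' lerDr addr_ge0 ?sqr_ge0.
  rewrite int01_cst /D' (ger0_norm D0) addrAC addrC lerDl.
  by rewrite addr_ge0 ?sqr_ge0// divr_ge0.
- have DD : D <= D'.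
    by rewrite /D' (ger0_norm D0) addrAC addrC lerDl addr_ge0 ?sqr_ge0// divr_ge0.
  move=> [k|]; last first.
    rewrite (int01_cst (D ^+ 2)) /= expr1n mulr1 -[leLHS]mulr1 ler_pM ?sqr_ge0//.
    by rewrite /D' -addrA lerDl addr_ge0// divr_ge0.
  apply: (int01_sqr_npiece z NI lJ ufree) => w.
  apply: le_trans (cnt _ _ w (leq_ord _) (leq_ord _)) _.
  rewrite ler_wpM2r ?sqr_ge0// ler_pM ?exprn_ge0//.
  by rewrite -natrX ler_nat; case/andP: NI.
- by rewrite sum_option /r /Z lerD2l pindex_sum_le.
- rewrite sum_option /r /W powR1 lerD2l.
  have qq : 0 < rho `^ (p - 1) < 1 by rewrite q0.
  apply: le_trans (pindex_sum_le I J qq).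
  by apply: ler_sum => k _; rewrite -!powR_mulrn ?powR_ge0 ?(ltW rho0)// powRAC.
Qed.

Lemma int01_sqr_expsum_le A N :
  int01 (fun y : R => Normc.normc (expsum A N y) ^+ 2) <= N%:R.
Proof.
have -> : (fun y : R => Normc.normc (expsum A N y) ^+ 2) =
    (fun y => Normc.normc (trigsum (fun n => (n.+1 \in A)%:R) N y) ^+ 2).
  apply/funext => y; rewrite expsumE; congr (_ ^+ 2).
  have -> : \sum_(n < N) (n.+1 \in A)%:R * expi (n.+1%:R * y) =
      expi y * trigsum (fun n => (n.+1 \in A)%:R) N y.
    rewrite /trigsum mulr_sumr; apply: eq_bigr => n _.
    by rewrite rmorph_nat mulrCA -expiD -natr1 mulrDl mul1r addrC.
  by rewrite Normc.normcM normc_expi mul1r.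
rewrite parseval -[N in leRHS]card_ord -sumr_const; apply: ler_sum => n _.
by case: (_ \in A); rewrite ?expr1n ?expr0n.
Qed.

Lemma normc_expsum_leN A N (y : R) : Normc.normc (expsum A N y) <= N%:R.
Proof.
rewrite expsumE; apply: le_trans (normc_sum _ _ _) _.
rewrite -[N in leRHS]card_ord -sumr_const; apply: ler_sum => n _.
rewrite Normc.normcM normc_expi mulr1.
by case: (_ \in A); rewrite ?Normc.normc0 ?Normc.normc1.
Qed.

(** All but two of the [p] factors are bounded by [N]; Parseval handles the remaining square. *)
Lemma int01_expsum_powR_ge2 A N (p : R) : 2 <= p -> (0 < N)%N ->
  int01 (fun y => Normc.normc (expsum A N y) `^ p) <= N%:R `^ (p - 1).
Proof.
move=> p2 N0; have cF := ccontinuous_normc (ccontinuous_expsum A N).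
have cF2 : continuous (fun y : R => Normc.normc (expsum A N y) ^+ 2).
  rewrite (_ : (fun _ => _) = (fun x => Normc.normc (expsum A N x) * Normc.normc (expsum A N x)))//.
  exact: continuous_mulf.
have NR : 0 < N%:R :> R by rewrite ltr0n.
apply: le_trans (_ : int01 (fun y : R => N%:R `^ (p - 2) * Normc.normc (expsum A N y) ^+ 2) <= _).
  apply: int01_le_dominated; first exact: measurable_continuous_powR.
    exact: continuous_scalef.
  move=> y; rewrite powR_ge0 /=; set t := Normc.normc _.
  have t0 : 0 <= t by exact: normc_ge0.
  have [->|tn0] := eqVneq t 0.
    by rewrite powR0 ?gt_eqF ?(lt_le_trans _ p2)// expr0n/= mulr0.
  have tp : 0 < t by rewrite lt_def tn0.
  rewrite -[in leLHS](subrK 2 p) (powRD_gt0 (p - 2) 2 tp) powR_mulrn// ler_wpM2r ?sqr_ge0//.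
  by rewrite ge0_ler_powR ?nnegrE ?subr_ge0// ?normc_expsum_leN// ltW.
rewrite int01Z//; apply: le_trans (ler_wpM2l (powR_ge0 _ _) (int01_sqr_expsum_le A N)) _.
rewrite (_ : p - 1 = p - 2 + 1); last by ring.
by rewrite (powRD_gt0 (p - 2) 1 NR) powRr1 ?(ltW NR).
Qed.

End Tame.

(** * Diophantine type and spacing of visits *)

Section Diophantine.
Context {R : realType}.

(** The lower limit is the supremum of the tail infima, so one of these is positive; lying below a
    real term, it is finite. *)
Lemma limn_einf_gt0 (v : nat -> R) : (0 < limn_einf (fun n => (v n)%:E))%E ->
  exists2 c : R, 0 < c & exists n0, forall n, (n0 <= n)%N -> c <= v n.
Proof.
rewrite limn_einf_lim (cvg_lim (@ereal_hausdorff R) (@cvg_einfs_sup R _)) => /ereal_sup_gt[_ [n0 _ <-]].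
set y := einfs _ n0 => y0.
have yv n : (n0 <= n)%N -> (y <= (v n)%:E)%E.
  by move=> n0n; apply: ereal_inf_lbound; exists n.
have := yv n0 (leqnn _); case: y y0 yv => [r| |]//= r0 rv _.
by exists r; [rewrite -lte_fin|exists n0 => n /rv; rewrite lee_fin].
Qed.

Lemma dist_int_le (x : R) (m : int) : dist_int x <= `|x - m%:~R|.
Proof.
apply: ge_inf; first by exists 0 => _ [n _ <-].
by exists m.
Qed.

(** Small [q] are reached by applying the asymptotic bound to [n1 * q] and [n1 * m], which costs the
    factor [n1 ^ (k + 1)]. *)
Lemma finite_type_bound (theta : R) : finite_diophantine_type theta ->
  exists2 k : nat, (0 < k)%N & exists2 c : R, 0 < c &
    forall (q : nat) (m : int), (0 < q)%N -> c <= q%:R ^+ k * `|q%:R * theta - m%:~R|.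
Proof.
move=> [k k0 /limn_einf_gt0[c c0 [n0 H]]]; exists k => //.
pose n1 := n0.+1; have n1R : 0 < n1%:R :> R by rewrite ltr0n.
exists (c / n1%:R ^+ k.+1); first by rewrite divr_gt0// exprn_gt0.
move=> q m q0; rewrite ler_pdivrMr ?exprn_gt0//.
have n0q : (n0 <= n1 * q)%N by rewrite (leq_trans (leqnSn n0))// leq_pmulr.
apply: le_trans (H _ n0q) _.
apply: le_trans (ler_wpM2l (exprn_ge0 _ _) (dist_int_le _ (n1%:Z * m))) _ => //.
rewrite natrM intrM exprMn -mulrA -mulrBr normrM ger0_norm ?(ltW n1R)//.
by rewrite exprS le_eqVlt; apply/orP; left; apply/eqP; ring.
Qed.

(** Pigeonhole: each block of [d] consecutive integers contains at most one element. *)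
Lemma count_spaced (P : pred nat) (M d : nat) : (0 < d)%N ->
  (forall n n', (n < n' < M)%N -> P n -> P n' -> (d <= n' - n)%N) ->
  (\sum_(n < M) P n <= M %/ d + 1)%N.
Proof.
move=> d0 H.
have -> : (\sum_(n < M) P n)%N = #|[pred n : 'I_M | P n]|.
  by rewrite -sum1_card [RHS]big_mkcond; apply: eq_bigr => n _; rewrite inE; case: (P n).
pose f (n : 'I_M) : 'I_(M %/ d).+1 := inord (n %/ d).
have fE n : f n = (n %/ d)%N :> nat by rewrite inordK// ltnS leq_div2r// ltnW.
rewrite -(card_in_imset (f := f)); last first.
  move=> n n' /[!inE] Pn Pn' /(congr1 (@nat_of_ord _)); rewrite !fE => nn'.
  apply: val_inj => /=.
  wlog lt_nn' : n n' Pn Pn' nn' / (n < n')%N => [W|].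
    by have [/W|/W W'|//] := ltngtP n n'; [exact|apply/esym/W'].
  have := H n n'; rewrite lt_nn' ltn_ord => /(_ isT Pn Pn').
  have := divn_eq n d; have := divn_eq n' d.
  have := ltn_pmod n' d0; rewrite -nn'; lia.
by apply: leq_trans (max_card _) _; rewrite card_ord addn1.
Qed.

Lemma intr_Zp_eq0 (Q : nat) (x : int) : (1 < Q)%N -> x%:~R = 0 :> 'Z_Q ->
  exists m : int, x = Q%:Z * m.
Proof.
move=> Q1 x0; have nat0 (n : nat) : n%:R = 0 :> 'Z_Q -> (Q %| n)%N.
  by rewrite Zp_nat => /(congr1 val) /=; rewrite Zp_cast// => /eqP.
case: x x0 => n.
  by rewrite -pmulrn => /nat0/dvdnP[m ->]; exists m%:Z; rewrite mulnC.
rewrite NegzE rmorphN /= => /eqP; rewrite oppr_eq0 -pmulrn => /eqP/nat0/dvdnP[m ->].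
by exists (- m%:Z); rewrite mulrN mulnC.
Qed.

Lemma intr_Zp_modulus (Q : nat) (m : int) : (1 < Q)%N -> (Q%:Z * m)%:~R = 0 :> 'Z_Q.
Proof.
move=> Q1; rewrite intrM (_ : Q%:Z%:~R = 0) ?mul0r//.
by rewrite -pmulrn pchar_Zp.
Qed.

Lemma in_arc_intrP (Q W : nat) (x : int) : (1 < Q)%N ->
  in_arc (1 : 'Z_Q) W x%:~R <-> exists m : int, 0 <= x + Q%:Z * m < W%:Z.
Proof.
move=> Q1; split=> [/existsP[i /eqP xi]|[m /andP[m0 mW]]].
  have : (x - i%:Z)%:~R = 0 :> 'Z_Q by rewrite rmorphB /= xi subrr.
  move=> /(intr_Zp_eq0 Q1)[m xm]; exists (- m).
  have iW := ltn_ord i; rewrite mulrN -xm; lia.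
pose v := x + Q%:Z * m; have vE : (absz v)%:Z = v by rewrite gez0_abs.
have iW : (absz v < W)%N by rewrite -ltz_nat vE.
apply/existsP; exists (Ordinal iW); apply/eqP => /=.
by rewrite [RHS]pmulrn vE rmorphD /= intr_Zp_modulus// addr0.
Qed.

Definition rot_visit (Q : nat) (a : int) (W : nat) (w : int) (n : nat) : bool :=
  in_arc (1 : 'Z_Q) W (w - a * n%:Z)%:~R.

Section Rotation.
Variables (gamma c : R) (k Q : nat) (a : int).
Hypothesis gammaP : forall (q : nat) (m : int), (0 < q)%N ->
  c <= q%:R ^+ k * `|q%:R * gamma - m%:~R|.
Hypothesis Q1 : (1 < Q)%N.
Hypothesis aQ : `|gamma * Q%:R - a%:~R| <= 1.

(** Subtracting the two lifts puts [a * d] within [W] of a multiple of [Q], where [d = n' - n].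
    Replacing [a] by [gamma * Q] costs at most [d], and the type bounds the distance of [d * gamma]
    to integers from below. *)
Lemma rotation_spacing (W n n' : nat) (w : int) : (n < n')%N ->
  rot_visit Q a W w n ->
  rot_visit Q a W w n' ->
  c * Q%:R <= (n' - n)%:R ^+ k * ((n' - n) + W)%:R.
Proof.
move=> nn' /(in_arc_intrP _ _ Q1)[m hm] /(in_arc_intrP _ _ Q1)[m' hm'].
have d0 : (0 < n' - n)%N by rewrite subn_gt0.
have QR : 0 < Q%:R :> R by rewrite ltr0n ltnW.
apply: le_trans (ler_wpM2r (ltW QR) (gammaP (m' - m) d0)) _.
rewrite -mulrA ler_wpM2l ?exprn_ge0// -[Q%:R in leLHS](ger0_norm (ltW QR)) -normrM.
set d := (n' - n)%N in d0 *.
have -> : (d%:R * gamma - (m' - m)%:~R) * Q%:R =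
    d%:R * (gamma * Q%:R - a%:~R) + (a * d%:Z - Q%:Z * (m' - m))%:~R.
  by rewrite !(rmorphB, rmorphM) /= -!pmulrn; ring.
apply: le_trans (ler_normD _ _) _; rewrite natrD lerD//.
  by rewrite normrM normr_nat -[leRHS]mulr1 ler_wpM2l.
rewrite -intr_norm -[W%:R]/(W%:Z%:~R) ler_int.
have dE : d%:Z = n'%:Z - n%:Z by rewrite /d subzn// ltnW.
have -> : a * d%:Z - Q%:Z * (m' - m) =
   (w - a * n%:Z + Q%:Z * m) - (w - a * n'%:Z + Q%:Z * m').
  by rewrite dE; ring.
lia.
Qed.

(** A gap below [2 ^ t] would contradict [rotation_spacing]; for [t = 0] gaps of at least one come
    for free. *)
Lemma rotation_count (W M t : nat) (w : int) :
  t = 0%N \/ (2 ^ (t * k))%:R * (M + W)%:R <= c * Q%:R ->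
  (\sum_(n < M) rot_visit Q a W w n <= M %/ 2 ^ t + 1)%N.
Proof.
move=> tP; apply: (@count_spaced (rot_visit Q a W w)).
  by rewrite expn_gt0.
move=> n n' /andP[nn' n'M] hn hn'; rewrite leqNgt; apply/negP => dt.
case: tP => [t0|tP]; first by move: dt; rewrite t0 expn0 ltnS leqn0 subn_eq0 leqNgt nn'.
have := le_trans tP (rotation_spacing nn' hn hn'); rewrite leNgt => /negP; apply.
rewrite -natrX -!natrM ltr_nat.
have h1 : ((n' - n) ^ k <= 2 ^ (t * k))%N 
    by rewrite expnM; case: (posnP k) => [->|k0]; rewrite ?expn0// leq_exp2r// ltnW.
apply: leq_ltn_trans (leq_mul h1 (leqnn _)) _.
by rewrite ltn_pmul2l ?expn_gt0// ltn_add2r (leq_ltn_trans (leq_subr _ _)).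
Qed.

End Rotation.
End Diophantine.

(** * The Beatty set compared with visits to an arc *)

Section BeattyModel.
Context {R : realType}.
Variables (alpha beta : R).
Hypothesis alpha0 : 0 < alpha.

Lemma in_beattyP (n : nat) : n \in beatty alpha beta <->
  (0 < n)%N /\ exists2 m : nat, (0 < m)%N & n%:R <= alpha * m%:R + beta < n%:R + 1.
Proof.
rewrite inE /beatty /=; split=> -[n0 [m m0 nm]]; split=> //; exists m => //.
  by move/esym/eqP: nm; rewrite floor_eq intrD.
by apply/esym/eqP; rewrite floor_eq intrD.
Qed.

Lemma in_beatty_invP (n : nat) : (0 < n)%N -> n \in beatty alpha beta <->
  exists2 m : nat, (0 < m)%N & 0 <= m%:R - alpha^-1 * n%:R + alpha^-1 * beta < alpha^-1.
Proof.
move=> n0; have aE (m : nat) : (n%:R <= alpha * m%:R + beta < n%:R + 1) =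
    (0 <= m%:R - alpha^-1 * n%:R + alpha^-1 * beta < alpha^-1).
  rewrite -[0 <= _](ler_pM2l alpha0) -[_ < alpha^-1](ltr_pM2l alpha0) mulr0.
  have -> : alpha * (m%:R - alpha^-1 * n%:R + alpha^-1 * beta) = alpha * m%:R + beta - n%:R.
    by field; rewrite gt_eqF.
  by rewrite divff ?gt_eqF// subr_ge0 ltrBlDr [1 + _]addrC.
rewrite in_beattyP; split=> [[_ [m m0]]|[m m0]]; first by rewrite aE; exists m.
by rewrite -aE; split=> //; exists m.
Qed.

Lemma rot_visitP (Q W : nat) (a w : int) (n : nat) : (1 < Q)%N ->
  rot_visit Q a W w n <-> exists m : int, 0 <= w - a * n%:Z + Q%:Z * m < W%:Z.
Proof. exact: in_arc_intrP. Qed.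

(** Membership asks for [0 <= y m < g * Q] with [m] positive, a visit for [0 <= v m < a + 1], where
    [v m] is the integer surrogate of [y m]. As [y m < v m + 1] and [v m < y m + N], a disagreement
    puts [v m] within [N + 2] of [0] or of [a + 1], a window of [2 * N + 5] integers. *)
Lemma beatty_model (N Q n n0 : nat) (a b : int) : alpha^-1 < 1 -> (1 < Q)%N ->
  a = Num.floor (alpha^-1 * Q%:R) -> b = Num.floor (Q%:R * alpha^-1 * beta) ->
  `|beta| <= n0%:R -> (n0 < n <= N)%N ->
  (n \in beatty alpha beta) (+) rot_visit Q a `|a|.+1 b n ->
  rot_visit Q a (2 * N + 5) (b + (N%:Z + 2)) n ||
  rot_visit Q a (2 * N + 5) (b + (N%:Z + 2) - (a + 1)) n.
Proof.
move=> g1 Q1 aE bE bn0 /andP[n0n nN].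
set g := alpha^-1 in g1 aE bE; have g0 : 0 < g by rewrite invr_gt0.
have QR : 0 < Q%:R :> R by rewrite ltr0n ltnW.
have n_gt0 : (0 < n)%N by apply: leq_trans n0n.
have nR : 1 <= n%:R :> R by rewrite ler1n.
have nNR : n%:R <= N%:R :> R by rewrite ler_nat.
have a0 : 0 <= a by rewrite aE floor_ge0 mulr_ge0// ltW.
have lE : `|a|.+1%:Z = a + 1 by rewrite -addn1 PoszD gez0_abs.
have [a1 a2] : a%:~R <= g * Q%:R /\ g * Q%:R < a%:~R + 1.
  by have := floor_itv (g * Q%:R); rewrite -aE intrD => /andP[].
have [b1 b2] : b%:~R <= Q%:R * g * beta /\ Q%:R * g * beta < b%:~R + 1.
  by have := floor_itv (Q%:R * g * beta); rewrite -bE intrD => /andP[].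
pose y (m : int) : R := Q%:R * (m%:~R - g * n%:R + g * beta).
pose v (m : int) : int := b - a * n%:Z + Q%:Z * m.
have vE m : (v m)%:~R = b%:~R - a%:~R * n%:R + Q%:R * m%:~R :> R.
  by rewrite /v !(rmorphB, rmorphD, rmorphM).
have yv m : y m < (v m)%:~R + 1.
  rewrite vE /y; have : 0 <= (g * Q%:R - a%:~R) * n%:R by rewrite mulr_ge0// subr_ge0.
  lra.
have vy m : (v m)%:~R < y m + N%:R.
  rewrite vE /y; have : (g * Q%:R - a%:~R) * n%:R < n%:R.
    by rewrite -[ltRHS]mul1r ltr_pM2r ?ltrBlDl// (lt_le_trans _ nR).
  lra.
case: (boolP (n \in beatty alpha beta)) => nB /=.
  move=> nv; apply/orP; right; apply/(rot_visitP _ _ _ _ Q1).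
  have [m m0 /andP[m1 m2]] := (in_beatty_invP n_gt0).1 nB.
  have y0 : 0 <= y m by rewrite /y mulr_ge0// ltW.
  have y1 : y m < g * Q%:R by rewrite /y mulrC ltr_pM2r.
  have v0 : -1 < v m by rewrite -(ltr_int R); have := yv m; lra.
  have vN : v m < a + 1 + N%:Z.
    have aN : (a + 1 + N%:Z)%:~R = a%:~R + 1 + N%:R :> R by rewrite !rmorphD.
    by rewrite -(ltr_int R) aN; have := vy m; lra.
  have vl : ~ (0 <= v m < `|a|.+1%:Z).
    by move=> H; move/negP: nv; apply; apply/(rot_visitP _ _ _ _ Q1); exists m.
  exists m; rewrite (_ : _ + _ = v m + (N%:Z + 2) - (a + 1)); last by rewrite /v; ring.
  by move: v0 vN vl; rewrite lE; move: (v m) => V; clear; lia.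
move=> /(rot_visitP _ _ _ _ Q1)[m]; rewrite lE -/(v m) => /andP[v0 v1].
have [y0|y0] := ltP (y m) 0.
  have vN : v m < N%:Z by rewrite -(ltr_int R); have := vy m; lra.
  apply/orP; left; apply/(rot_visitP _ _ _ _ Q1).
  exists m; rewrite (_ : _ + _ = v m + (N%:Z + 2)); last by rewrite /v; ring.
  by move: v0 vN; move: (v m) => V; clear; lia.
have [y1|y1] := ltP (y m) (g * Q%:R).
  move: y0 y1; rewrite /y [g * Q%:R]mulrC pmulr_rge0// ltr_pM2l// => y0 y1.
  (* The Beatty index must be positive: [y m >= 0] gives [m >= g * (n - beta)], and
     [n > n0 >= |beta|]. *)
  have m0 : 0 < m.
    rewrite -(ltr_int R); apply: lt_le_trans (_ : g * (n%:R - beta) <= _); last lra.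
    rewrite mulr_gt0// subr_gt0; apply: le_lt_trans (ler_norm _) _.
    by apply: le_lt_trans bn0 _; rewrite ltr_nat.
  exfalso; move/negP: nB; apply; apply/(in_beatty_invP n_gt0).
  have mE : m%:~R = `|m|%N%:R :> R by rewrite pmulrn gez0_abs// ltW.
  by exists `|m|%N; [rewrite absz_gt0 gt_eqF|rewrite -mE y0].
have va : a < v m + 1 by rewrite -(ltr_int R) [ltRHS]rmorphD /=; have := yv m; lra.
apply/orP; right; apply/(rot_visitP _ _ _ _ Q1).
exists m; rewrite (_ : _ + _ = v m + (N%:Z + 2) - (a + 1)); last by rewrite /v; ring.
by move: va v1; move: (v m) => V; clear; lia.
Qed.

End BeattyModel.

(** * Choice of parameters: Beatty sets are tame *)

Section BeattyTame.
Context {R : realType}.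

Lemma root_half_exists (n : nat) : (0 < n)%N ->
  exists2 rho : R, 0 < rho < 1 & rho ^+ n = 2^-1.
Proof.
move=> n0; pose rho : R := 2^-1 `^ n%:R^-1.
have rho0 : 0 < rho by rewrite powR_gt0.
have rhoE : rho ^+ n = 2^-1.
  rewrite -powR_mulrn ?(ltW rho0)// -powRrM mulVf ?powRr1//.
  by rewrite pnatr_eq0 -lt0n.
exists rho => //; rewrite rho0 ltNge; apply/negP => /(exprn_ege1 n).
by rewrite rhoE; lra.
Qed.

(** The trivial count gives the decay in [I - i], the spacing count that in [J - j]. Lowering [j] by
    [K] raises [t] by one, so one halving is spread over [K] scales; the 4 in [4 * K] comes from
    squaring [rho ^ 2]. *)
Lemma visits_bound (rho : R) (K c1 I J i j s t : nat) : (0 < K)%N ->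
  0 < rho < 1 -> rho ^+ (4 * K) = 2^-1 ->
  (i <= I)%N -> t = ((J - j) %/ K - c1)%N -> (t <= I)%N ->
  (s <= 3 * 2 ^ i)%N -> (s <= (3 * 2 ^ i) %/ 2 ^ t + 1)%N ->
  s%:R <= (2 ^ (c1 + 5))%:R * 2 ^+ I * (rho ^+ ((I - i) + (J - j))) ^+ 2.
Proof.
move=> K0 /andP[rho0 rho1] rhoK iI tE tI s1 s2.
have powle (m n : nat) : (n <= m)%N -> rho ^+ m <= rho ^+ n.
  by move=> nm; rewrite ler_wiXn2l ?(ltW rho0) ?(ltW rho1).
have half m : (2 ^ m)%:R * rho ^+ (4 * K * m) = 1 :> R.
  by rewrite natrX exprM rhoK exprVn divff// expf_neq0// pnatr_eq0.
(* The two bounds on [s] are combined through their geometric mean. *)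
have E1 : (s * s * (2 ^ (I - i) * 2 ^ t) <= 12 * (2 ^ I * 2 ^ I))%N.
  have e1 : ((3 * 2 ^ i) %/ 2 ^ t * 2 ^ t <= 3 * 2 ^ i)%N := leq_divM _ _.
  have e2 : (2 ^ t <= 2 ^ I)%N by rewrite leq_exp2l.
  have e3 : (2 ^ i <= 2 ^ I)%N by rewrite leq_exp2l.
  have e4 : (2 ^ (I - i) * 2 ^ i = 2 ^ I)%N by rewrite -expnD subnK.
  have e5 : (s * 2 ^ t <= 4 * 2 ^ I)%N.
    apply: leq_trans (leq_mul s2 (leqnn _)) _; rewrite mulnDl; lia.
  have e6 : (s * 2 ^ (I - i) <= 3 * 2 ^ I)%N.
    by apply: leq_trans (leq_mul s1 (leqnn _)) _; rewrite -mulnA [(2 ^ i * _)%N]mulnC e4.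
  have := leq_mul e6 e5; rewrite mulnACA; lia.
(* [t + c1 + 1] exceeds [(J - j) / K] even where the truncated subtraction makes [t] zero. *)
have E2 : (2 ^ t)%:R * ((2 ^ (c1 + 1))%:R * rho ^+ (4 * (J - j))) >= 1 :> R.
  rewrite -[leLHS](half (t + (c1 + 1))%N) expnD natrM -mulrA ler_wpM2l// ler_wpM2l//.
  apply: powle; rewrite -mulnA leq_mul2l /=.
  have := ltn_ceil (J - j) K0; rewrite mulnC => /ltnW/leq_trans; apply.
  by rewrite leq_mul2l; apply/orP; right; rewrite tE; lia.
have E3 : (2 ^ (I - i))%:R * rho ^+ (4 * (I - i)) >= 1 :> R.
  rewrite -[leLHS](half (I - i)%N) ler_wpM2l//; apply: powle.
  by rewrite -mulnA leq_mul2l /= leq_pmull.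
rewrite -(@ler_pXn2r _ 2) ?nnegrE ?mulr_ge0 ?exprn_ge0 ?(ltW rho0)//.
apply: le_trans (_ : s%:R ^+ 2 * ((2 ^ (I - i))%:R * rho ^+ (4 * (I - i))) *
   ((2 ^ t)%:R * ((2 ^ (c1 + 1))%:R * rho ^+ (4 * (J - j)))) <= _).
  rewrite -[leLHS]mulr1 ler_pM ?sqr_ge0// -[leLHS]mulr1 ler_pM ?sqr_ge0//.
have -> : s%:R ^+ 2 * ((2 ^ (I - i))%:R * rho ^+ (4 * (I - i))) *
   ((2 ^ t)%:R * ((2 ^ (c1 + 1))%:R * rho ^+ (4 * (J - j)))) =
   (s * s * (2 ^ (I - i) * 2 ^ t))%:R * ((2 ^ (c1 + 1))%:R * (rho ^+ ((I - i) + (J - j))) ^+ 4).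
  have -> : rho ^+ (I - i + (J - j)) ^+ 4 = rho ^+ (4 * (I - i)) * rho ^+ (4 * (J - j)).
    by rewrite -exprM mulnC mulnDr exprD.
  by rewrite !natrM; move: (rho ^+ _) (rho ^+ _) => x y; ring.
have -> : ((2 ^ (c1 + 5))%:R * 2 ^+ I * rho ^+ (I - i + (J - j)) ^+ 2) ^+ 2 =
   (2 ^ (c1 + 5) * 2 ^ (c1 + 5) * (2 ^ I * 2 ^ I))%:R * (rho ^+ ((I - i) + (J - j))) ^+ 4 :> R.
  by rewrite !natrM !natrX; move: (rho ^+ _) => x; ring.
rewrite mulrA ler_wpM2r ?exprn_ge0 ?(ltW rho0)// -natrM ler_nat.
apply: leq_trans (leq_mul E1 (leqnn _)) _.
rewrite !expnD mulnAC leq_mul2r; apply/orP; right.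
have : (0 < 2 ^ c1)%N by rewrite expn_gt0.
by rewrite (_ : 2 ^ 5 = 32)%N// expn1; nia.
Qed.


Lemma budget_le (c : R) (c1 X Q : nat) : 16 <= c * (2 ^ c1)%:R ->
  (X * 2 ^ c1 <= 16 * Q)%N -> X%:R <= c * Q%:R.
Proof.
move=> hc hX; have p0 : 0 < (2 ^ c1)%:R :> R by rewrite ltr0n expn_gt0.
rewrite -(ler_pM2r p0) -natrM; apply: le_trans (_ : (16 * Q)%:R <= _).
  by rewrite ler_nat.
by rewrite natrM mulrAC ler_wpM2r.
Qed.

Lemma sum_ltn_le (N n0 : nat) : (\sum_(n < N) (n < n0) <= n0)%N.
Proof.
rewrite (_ : (\sum_(n < N) (n < n0))%N = minn N n0) ?geq_minr//.
by elim: N => [|N IH]; rewrite ?big_ord0 ?min0n// big_ord_recr /= IH; lia.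
Qed.

Lemma trunc_log2_bounds (n : nat) : (0 < n)%N ->
  (2 ^ trunc_log 2 n <= n <= 2 ^ (trunc_log 2 n).+1)%N.
Proof.
by move=> n0; have /andP[-> /ltnW] := @trunc_log_bounds 2 n isT n0.
Qed.

Lemma scale_le (K I J j c1 : nat) : (0 < K)%N -> (0 < c1)%N -> (J <= K * I.+1)%N ->
  ((J - j) %/ K - c1 <= I)%N.
Proof.
move=> K0 c10 JK; have : ((J - j) %/ K <= I.+1)%N.
  by rewrite -[leqRHS](mulKn _ K0) leq_div2r// (leq_trans (leq_subr _ _)).
by move: (_ %/ _)%N => d; lia.
Qed.

Lemma scale_mul (K d t c1 : nat) : (0 < t)%N -> t = (d %/ K - c1)%N -> (K * (t + c1) <= d)%N.
Proof.
move=> t0 tE; apply: leq_trans (leq_divM d K); rewrite mulnC leq_mul2r.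
by apply/orP; right; move: tE; move: (_ %/ _)%N => e; lia.
Qed.

(** With [length_exponent_le], this is where [Q] needs the exponent [k + 1]: separation [2 ^ t]
    costs [2 ^ (t * k)] times the arc length or the number of steps. *)
Lemma arc_exponent_le (k t c1 j J I1 : nat) : (k.+1 * (t + c1) <= J - j)%N ->
  (j <= J)%N -> (J <= k.+1 * I1)%N -> (t * k + j + c1 <= k.+1 * I1)%N.
Proof.
rewrite !mulSn !mulnDr (mulnC k t); move: (t * k)%N (k * c1)%N (k * I1)%N => x y w; lia.
Qed.

Lemma length_exponent_le (k t c1 i I1 : nat) : (0 < k)%N -> (t + c1 <= I1)%N ->
  (i <= I1)%N -> (t * k + i + c1 <= k.+1 * I1)%N.
Proof.
move=> k0 tI iI; have := leq_mul (leqnn k) tI; rewrite mulnDr (mulnC k t) mulSn.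
have : (c1 <= k * c1)%N by rewrite leq_pmull.
by move: (t * k)%N (k * c1)%N (k * I1)%N => x y w; lia.
Qed.

Lemma window_budget (x m w c1 Q : nat) : (x * m * 2 ^ c1 <= Q)%N -> (x * w * 2 ^ c1 <= Q)%N ->
  (x * (3 * m + 3 * w) * 2 ^ c1 <= 16 * Q)%N.
Proof.
rewrite mulnDr mulnDl !(mulnCA x) -!(mulnA 3).
by move: (x * m * _)%N (x * w * _)%N => y z; lia.
Qed.

Lemma rot_orbitE (Q : nat) (a w : int) (n : nat) :
  w%:~R + (- a)%:~R *+ n = (w - a * n%:Z)%:~R :> 'Z_Q.
Proof. by rewrite rmorphB rmorphM /= rmorphN mulNrn -pmulrn mulr_natr. Qed.

Lemma sum_rot_visitE (Q W M : nat) (a : int) (w : 'Z_Q) :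
  (\sum_(n < M) in_arc (1%R : 'Z_Q) W (w + (- a)%:~R *+ n)%R)%N =
  (\sum_(n < M) rot_visit Q a W (w : nat)%:Z n)%N.
Proof.
apply: eq_bigr => n _; rewrite /rot_visit -rot_orbitE; congr (nat_of_bool (in_arc _ _ (_ + _))).
by rewrite -pmulrn natr_Zp.
Qed.

Lemma tame_beatty_gt1 (alpha beta : R) (k : nat) (c : R) : 0 < alpha -> alpha^-1 < 1 ->
  (0 < k)%N -> 0 < c ->
  (forall (q : nat) (m : int), (0 < q)%N ->
     c <= q%:R ^+ k * `|q%:R * alpha^-1 - m%:~R|) ->
  exists (K : nat) (D rho : R), 0 < rho < 1 /\
    forall N : nat, (0 < N)%N -> tame (beatty alpha beta) K D rho N.
Proof.
move=> alpha0 g1 k0 c0 gP; pose K := k.+1.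
have [rho rho01 rhoK] : exists2 rho : R, 0 < rho < 1 & rho ^+ (4 * K) = 2^-1.
  exact: root_half_exists.
(* [2 ^ c1] absorbs the Diophantine constant; 16 leaves room for the tripled windows ([3 + 3]) and
   for [N + (2 * N + 5)]. *)
pose c1 := (Num.truncn (16 / c)).+1.
have c1P : 16 <= c * (2 ^ c1)%:R.
  rewrite mulrC -ler_pdivrMr//; apply: le_trans (ltW (truncnS_gt _)) _.
  by rewrite ler_nat ltnW// ltn_expl.
pose n0 := (Num.truncn `|beta|).+1.
have bn0 : `|beta| <= n0%:R by exact: ltW (truncnS_gt _).
(* The summands pay for the visit counts, for the integers up to [n0], and for visits to the two end
   windows. *)
pose D := (2 ^ (c1 + 5) + (n0 + 2 * (2 ^ c1 + 1)))%N.
exists K, D%:R, rho; split=> // N N0.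
pose I := trunc_log 2 N; pose Q := (2 ^ (K * I.+1))%N.
have NI := trunc_log2_bounds N0.
have Q1 : (1 < Q)%N by rewrite -{1}(expn0 2) ltn_exp2l// muln_gt0.
have QR : 0 < Q%:R :> R by rewrite ltr0n ltnW.
have g0 : 0 < alpha^-1 by rewrite invr_gt0.
pose a := Num.floor (alpha^-1 * Q%:R); pose b := Num.floor (Q%:R * alpha^-1 * beta).
have a0 : 0 <= a by rewrite floor_ge0 mulr_ge0// ltW.
have [a1 a2] : a%:~R <= alpha^-1 * Q%:R /\ alpha^-1 * Q%:R < a%:~R + 1.
  by have := floor_itv (alpha^-1 * Q%:R); rewrite -/a intrD => /andP[].
have aQ : `|alpha^-1 * Q%:R - a%:~R| <= 1.
  by rewrite ger0_norm ?subr_ge0// lerBlDl ltW.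
pose l := `|a|.+1; pose J := trunc_log 2 l.
(* Here [1 / alpha < 1] enters: the arc does not wrap around Z/Q, hence is free. *)
have lQ : (l <= Q)%N.
  rewrite -ltz_nat gez0_abs// -(ltr_int R); apply: le_lt_trans a1 _.
  by rewrite -[ltRHS]mul1r ltr_pM2r.
have lJ := @trunc_log2_bounds l isT.
have JK : (J <= K * I.+1)%N.
  by rewrite -(@leq_exp2l 2)//; case/andP: lJ => lJ _; apply: leq_trans lQ.
have count := rotation_count gP Q1 aQ.
(* The base point is [b - a] because step [n] of the orbit represents the integer [n.+1]. *)
exists 'Z_Q, (- a)%:~R, 1, (b - a)%:~R, l, I, J; split=> //.
- move=> i j il jl; have iQ : (i < Q)%N by exact: leq_trans lQ.
  have jQ : (j < Q)%N by exact: leq_trans lQ.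
  by rewrite !Zp_nat => /(congr1 val) /=; rewrite Zp_cast// !modn_small.
- move=> i j w iI jJ; rewrite sum_rot_visitE.
  pose t := ((J - j) %/ K - c1)%N.
  have tI : (t <= I)%N by exact: scale_le.
  apply: le_trans (@visits_bound rho K c1 I J i j _ t _ rho01 rhoK iI erefl tI _ _) _ => //.
  + rewrite -[leqRHS]card_ord -sum1_card; apply: leq_sum => n _; exact: leq_b1.
  + apply: count; case: (posnP t) => [->|t0]; [by left|right].
    rewrite -natrM; apply: budget_le c1P _.
    have tc : (K * (t + c1) <= J - j)%N by exact: scale_mul.
    apply: window_budget; rewrite -!expnD leq_exp2l//; last exact: arc_exponent_le tc jJ JK.
    apply: length_exponent_le; rewrite ?(leq_trans iI)//.
    by rewrite -(@leq_pmul2l K)//; apply: leq_trans JK; apply: leq_trans tc (leq_subr _ _).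
  + rewrite ler_wpM2r ?sqr_ge0// ler_wpM2r ?exprn_ge0// ler_nat; exact: leq_addr.
- rewrite ler_nat.
  (* Separation [2 ^ t] is of order [N], so each end window is visited at most [2 ^ c1 + 1]
     times. *)
  pose t := (I.+1 - c1)%N.
  have tP W w : (W <= 2 * N + 5)%N ->
      (\sum_(n < N) rot_visit Q a W w n <= 2 ^ c1 + 1)%N.
    move=> WN; have N2 : (N < 2 ^ I.+1)%N by have /andP[] := @trunc_log_bounds 2 N isT N0.
    apply: leq_trans (count W N t w _) _.
      case: (posnP t) => [->|t0]; [by left|right].
      rewrite -natrM; apply: budget_le c1P _.
      have e1 : (2 ^ (t * k) * 2 ^ I.+1 * 2 ^ c1 <= Q)%N.
        rewrite -!expnD leq_exp2l//; apply: length_exponent_le => //.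
        by rewrite subnK// ltnW// -subn_gt0.
      have e2 : (N + W <= 16 * 2 ^ I.+1)%N.
        by move: WN N2 N0; move: (2 ^ I.+1)%N; clear; lia.
      apply: leq_trans (_ : 16 * (2 ^ (t * k) * 2 ^ I.+1 * 2 ^ c1) <= _)%N; last by rewrite leq_mul2l.
      by rewrite [leqRHS]mulnA leq_mul2r [leqRHS]mulnCA leq_mul2l e2 !orbT.
    rewrite leq_add2r -ltnS ltn_divLR ?expn_gt0//.
    apply: leq_trans N2 _; apply: leq_trans (_ : 2 ^ (c1 + t) <= _)%N.
      by rewrite leq_exp2l// -leq_subLR.
    by rewrite expnD leq_mul2r leqnSn orbT.
  apply: leq_trans (_ : \sum_(n < N) ((n < n0) +
     (rot_visit Q a (2 * N + 5) (b - a + (N%:Z + 2)) n +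
      rot_visit Q a (2 * N + 5) (b - a + (N%:Z + 2) - (a + 1)) n)) <= _)%N; last first.
    rewrite !big_split /= /D; apply: leq_trans (leq_addl _ _); apply: leq_add.
      exact: sum_ltn_le.
    by rewrite [leqRHS]mul2n -addnn; apply: leq_add; exact: tP.
  apply: leq_sum => n _.
  have [nn0|nn0] := ltnP n n0; first by rewrite addSn; case: (_ (+) _).
  have sh w : rot_visit Q a (2 * N + 5) (w - a) n = rot_visit Q a (2 * N + 5) w n.+1.
    by congr (in_arc _ _ _%:~R); rewrite -addn1 PoszD; ring.
  rewrite add0n !(addrAC b (- a)) (addrAC _ (- a)) !sh.
  have := @beatty_model R alpha beta alpha0 N Q n.+1 n0 a b g1 Q1 erefl erefl bn0.
  rewrite ltnS nn0 ltn_ord => /(_ isT).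
  rewrite rot_orbitE /rot_visit (_ : b - a - a * n%:Z = b - a * n.+1%:Z); last first.
    by rewrite -addn1 PoszD; ring.
  case: (_ (+) _) => //= /(_ isT) /orP[->|->] //; by rewrite addnC.
Qed.

Lemma tame_beatty_lt1 (alpha beta : R) : 0 < alpha < 1 ->
  exists (K : nat) (D rho : R), 0 < rho < 1 /\
    forall N : nat, (0 < N)%N -> tame (beatty alpha beta) K D rho N.
Proof.
move=> /andP[alpha0 alpha1].
have [rho rho01 rhoK] : exists2 rho : R, 0 < rho < 1 & rho ^+ (4 * 1) = 2^-1.
  exact: root_half_exists.
pose n0 := (Num.truncn `|beta|).+1.
have bn0 : `|beta| <= n0%:R by exact: ltW (truncnS_gt _).
exists 1%N, (2 ^ 5 + n0)%:R, rho; split=> // N N0.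
pose I := trunc_log 2 N.
have all_arc W (w : 'I_1) : (0 < W)%N -> in_arc (0 : 'I_1) W w.
  by move=> W0; apply/existsP; exists (Ordinal W0); rewrite [w]ord1 [X in _ == X]ord1.
exists 'I_1, 0, 0, 0, 1%N, I, 0%N; split=> //; first exact: trunc_log2_bounds.
- by case=> // -[].
- move=> i j w iI; rewrite leqn0 => /eqP ->.
  apply: le_trans (@visits_bound rho 1 0 I 0 i 0 _ 0 _ rho01 rhoK iI erefl _ _ _) _ => //.
  + rewrite -[leqRHS]card_ord -sum1_card; apply: leq_sum => n _; exact: leq_b1.
  + rewrite expn0 divn1; apply: leq_trans (leq_addr _ _).
    rewrite -[leqRHS]card_ord -sum1_card; apply: leq_sum => n _; exact: leq_b1.
  + rewrite ler_wpM2r ?sqr_ge0// ler_wpM2r ?exprn_ge0// ler_nat; exact: leq_addr.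
- rewrite ler_nat; apply: leq_trans (leq_addl _ _).
  apply: leq_trans (_ : \sum_(n < N) (n < n0) <= _)%N; last exact: sum_ltn_le.
  apply: leq_sum => n _; rewrite all_arc// addbT.
  have [nn0|nn0] := ltnP n n0; first exact: leq_b1.
  suff -> : n.+1 \in beatty alpha beta by [].
  apply/(in_beattyP alpha beta); split=> //.
  (* The first [m] with [alpha * m + beta >= n.+1] overshoots by less than [alpha < 1]. *)
  pose m := Num.ceil ((n.+1%:R - beta) / alpha).
  have h : 0 < n.+1%:R - beta.
    rewrite subr_gt0; apply: le_lt_trans (ler_norm _) _; apply: le_lt_trans bn0 _.
    by rewrite ltr_nat ltnS.
  have m0 : 0 < m by rewrite ceil_gt0 divr_gt0.
  have mE : `|m|%N%:R = m%:~R :> R by rewrite pmulrn gez0_abs// ltW.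
  exists `|m|%N; first by rewrite absz_gt0 gt_eqF.
  have := ceil_itv ((n.+1%:R - beta) / alpha); rewrite -/m mE intrB => /andP[].
  rewrite ltr_pdivlMr// ler_pdivrMr// => h1 h2.
  by apply/andP; split; [lra|nra].
Qed.

Lemma tame_beatty (alpha beta : R) : 0 < alpha -> finite_diophantine_type (1 / alpha) ->
  exists (K : nat) (D rho : R), 0 < rho < 1 /\
    forall N : nat, (0 < N)%N -> tame (beatty alpha beta) K D rho N.
Proof.
move=> alpha0; rewrite div1r => /finite_type_bound[k k0 [c c0 gP]].
have [g1|g1|g1] := ltgtP alpha^-1 1.
- exact: tame_beatty_gt1 g1 k0 c0 gP.
- by apply: tame_beatty_lt1; rewrite alpha0 -invf_gt1.
(* For [alpha = 1] the choice [q = m = 1] would give [c <= 0]. *)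
- have := gP 1%N 1 isT; rewrite g1 mul1r subrr normr0 mulr0.
  by rewrite leNgt c0.
Qed.

End BeattyTame.

(** * Lower density of the Beatty set, and logarithms against powers *)

Section Density.
Context {R : realType}.

Lemma quotient_lower (H L N : nat) : (4 * H <= N)%N -> (N < L.+1 * (2 * H))%N ->
  (N <= 4 * H * L)%N.
Proof. by rewrite [(L.+1 * _)%N]mulSn [(L * _)%N]mulnC -!mulnA; move: (H * L)%N => x; lia. Qed.

(** Along the indices [h * j + m0], with [alpha * h > 1], the floors are positive and strictly
    increasing, hence distinct elements, and they grow at most linearly in [j]. *)
Lemma beatty_density (alpha beta : R) : 0 < alpha ->
  exists2 delta : R, 0 < delta & exists2 N0 : nat, (0 < N0)%N &
    forall N, (N0 <= N)%N -> delta * N%:R <= (size (upto (beatty alpha beta) N))%:R.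
Proof.
move=> alpha0.
pose h := (Num.truncn alpha^-1).+1; pose m0 := (Num.truncn ((1 + `|beta|) / alpha)).+1.
have h1 : 1 < alpha * h%:R by rewrite mulrC -ltr_pdivrMr// div1r truncnS_gt.
pose f (j : nat) : R := alpha * (h * j + m0)%:R + beta.
have f1 j : 1 <= f j.
  have : (1 + `|beta|) < alpha * m0%:R by rewrite mulrC -ltr_pdivrMr// truncnS_gt.
  have : 0 <= alpha * (h * j)%:R by rewrite mulr_ge0// ltW.
  by rewrite /f natrD mulrDr; have := ler_norm (- beta); rewrite normrN; lra.
have fS j : f j + 1 <= f j.+1.
  rewrite /f mulnS !natrD !mulrDr; lra.
pose n (j : nat) := Num.truncn (f j).
have f0 j : 0 <= f j by rewrite (le_trans _ (f1 j)).
have nE j : (n j)%:R <= f j < (n j).+1%:R by exact: truncn_itv.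
have nS j : (n j < n j.+1)%N.
  have /andP[a1 _] := nE j; have /andP[_ a2] := nE j.+1.
  rewrite -ltnS -(ltr_nat R); apply: le_lt_trans a2.
  by apply: le_trans (fS j); rewrite -natr1 lerD2r.
have nB j : n j \in beatty alpha beta.
  apply/(in_beattyP alpha beta); split.
    by rewrite -(ltr_nat R) -[_ < _]/(0 < _); have := nE j; have := f1 j; rewrite -natr1; lra.
  exists (h * j + m0)%N; first by rewrite addnS.
  by have := nE j; rewrite -natr1.
pose H := (Num.truncn (alpha * h%:R)).+1.
pose B := (Num.truncn (f 0)).+1.
have fB j : f j <= (H * j + B)%:R.
  have -> : f j = alpha * h%:R * j%:R + f 0.
    by rewrite /f muln0 add0n natrD natrM; ring.
  rewrite natrD natrM lerD ?(ltW (truncnS_gt _))// ler_wpM2r//.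
  exact: ltW (truncnS_gt _).
exists (4 * H)%:R^-1; first by rewrite invr_gt0 ltr0n.
exists (4 * H + 2 * B)%N; first by rewrite addn_gt0.
move=> N NN; pose L := (N %/ (2 * H))%N.
have LN : (4 * H * L >= N)%N.
  by apply: quotient_lower; [exact: leq_trans (leq_addr _ _) NN|exact: ltn_ceil].
apply: le_trans (_ : L%:R <= _).
  by rewrite ler_pdivrMl ?ltr0n// -natrM ler_nat.
rewrite ler_nat -[L](size_iota 0) -(size_map n); apply: uniq_leq_size.
  rewrite map_inj_uniq ?iota_uniq// => j j' E.
  have mono := homo_ltn ltn_trans nS.
  by case: (ltngtP j j') => // /mono; rewrite E ltnn.
move=> x /mapP[j]; rewrite mem_iota add0n => /andP[_ jL] ->.
rewrite mem_filter nB mem_index_iota /= ltnS; apply/andP; split.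
  by have /(in_beattyP alpha beta)[] := nB j.
rewrite -(ler_nat R); have /andP[a1 _] := nE j; apply: le_trans a1 _.
apply: le_trans (fB j) _; rewrite ler_nat.
have L2 : (2 * H * L <= N)%N by rewrite mulnC leq_divM.
have Lj : (H * j <= H * L)%N by rewrite leq_mul2l ltnW// orbT.
have BN : (2 * B <= N)%N by apply: leq_trans NN; exact: leq_addl.
rewrite -(@leq_pmul2l 2)// mulnDr [leqRHS]mul2n -addnn leq_add// (leq_trans _ L2)//.
by rewrite -mulnA leq_mul2l Lj orbT.
Qed.

(** The constant is 1 because weak subconvexity fixes its constant before [eps]. From
    [ln x <= x ^ e4 / e4] with [e4 = eps / 4], the square is at most [M * N ^ (eps / 2)], and
    [M <= N ^ (eps / 2)] for large [N]. *)
Lemma ln_sqr_le_powR (eps : R) : 0 < eps ->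
  exists N0 : nat, forall N, (0 < N)%N -> (N0 <= N)%N -> ln (2 * N%:R) ^+ 2 <= N%:R `^ eps :> R.
Proof.
move=> e0; pose e4 := eps / 4; have e40 : 0 < e4 by rewrite divr_gt0.
pose M : R := 2 `^ (2 * e4) / e4 ^+ 2.
have M0 : 0 < M by rewrite divr_gt0 ?powR_gt0// exprn_gt0.
exists (Num.truncn (M `^ (2 * e4)^-1)).+1 => N N0 NN.
have NR : 0 < N%:R :> R by rewrite ltr0n.
have MN : M <= N%:R `^ (2 * e4).
  have e20 : 2 * e4 != 0 by rewrite mulf_neq0// gt_eqF.
  have -> : M = (M `^ (2 * e4)^-1) `^ (2 * e4).
    by rewrite -powRrM mulVf// powRr1 ?(ltW M0).
  have e24 : 0 <= 2 * e4 by rewrite pmulr_rge0// ltW.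
  rewrite ge0_ler_powR ?nnegrE ?powR_ge0//.
  apply: le_trans (ltW (truncnS_gt _)) _.
  by rewrite ler_nat.
have ln0 : 0 <= ln (2 * N%:R) :> R.
  by rewrite ln_ge0// -natrM ler1n muln_gt0.
have lnle : ln (2 * N%:R) <= (2 * N%:R) `^ e4 / e4 :> R.
  rewrite ler_pdivlMr// mulrC -ln_powR ltW// ln_sublinear// powR_gt0// mulr_gt0//.
have q0 : 0 <= (2 * N%:R) `^ e4 / e4 :> R by rewrite divr_ge0 ?powR_ge0 ?ltW.
apply: le_trans (_ : ((2 * N%:R) `^ e4 / e4) ^+ 2 <= _); first by rewrite ler_pXn2r.
rewrite expr_div_n -powR_mulrn ?powR_ge0// -powRrM (mulrC e4) powRM ?(ltW NR)//.
rewrite (_ : eps = 2 * e4 + 2 * e4); last by rewrite /e4; field.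
rewrite (powRD_gt0 _ _ NR) [leLHS]mulrAC ler_wpM2r ?powR_ge0//.
Qed.

End Density.

Theorem theorem2p3 (R : realType) (alpha beta : R) (halpha : 0 < alpha)
    (htype : finite_diophantine_type (1 / alpha)) :
  [/\ exists2 C : R, 0 < C & forall N : nat, (0 < N)%N ->
        \int[lebesgue_measure]_(theta in `[0, 1])
           ComplexField.Normc.normc (expsum (beatty alpha beta) N theta)
          <= C * ln (2 * N%:R) ^+ 2,
      forall p : R, 1 < p ->
        exists2 C : R, 0 < C & forall N : nat, (0 < N)%N ->
          \int[lebesgue_measure]_(theta in `[0, 1])
             (ComplexField.Normc.normc (expsum (beatty alpha beta) N theta)
                `^ p)
            <= C * N%:R `^ (p - 1),
      weakly_subconvex (1 : R) (beatty alpha beta) &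
      forall p : R, 1 < p < 2 -> strongly_subconvex p (beatty alpha beta)].
Proof.
have [K [D [rho [rho01 tameB]]]] := tame_beatty beta halpha htype.
have [delta delta0 [N0 N00 dens]] := beatty_density beta halpha.
have L1 : exists2 C : R, 0 < C & forall N : nat, (0 < N)%N ->
    int01 (fun y => Normc.normc (expsum (beatty alpha beta) N y)) <= C * ln (2 * N%:R) ^+ 2.
  exists ((10 * K.+1%:R + D) / ln 2 ^+ 2).
    have D0 := tame_ge0 (tameB 1%N isT).
    by rewrite divr_gt0 ?exprn_gt0 ?ln_gt0 ?ltr1n// ltr_pwDl// mulr_gt0.
  by move=> N N_gt0; apply: (int01_expsum_tame N_gt0 (tameB N N_gt0)).
have Lp (p : R) : 1 < p -> exists2 C : R, 0 < C & forall N : nat, (0 < N)%N ->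
    int01 (fun y => Normc.normc (expsum (beatty alpha beta) N y) `^ p) <= C * N%:R `^ (p - 1).
  move=> p1; have [p2|p2] := leP p 2.
    have p12 : 1 < p <= 2 by rewrite p1.
    have [C C0 HC] := int01_expsum_powR_tame (beatty alpha beta) K D p12 rho01.
    by exists C => // N N_gt0; apply: HC => //; exact: tameB.
  exists 1 => // N N_gt0; rewrite mul1r; apply: int01_expsum_powR_ge2 => //.
  exact: ltW.
have nonempty : beatty alpha beta !=set0.
  have : 0 < (size (upto (beatty alpha beta) N0))%:R :> R.
    by apply: lt_le_trans (dens _ (leqnn _)); rewrite mulr_gt0// ltr0n.
  rewrite ltr0n; case E : (upto _ _) => [//|x s] _; exists x.
  have : x \in upto (beatty alpha beta) N0 by rewrite E mem_head.
  by rewrite mem_filter => /andP[/set_mem].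
have positive : beatty alpha beta `<=` [set n | (0 < n)%N] by move=> n [].
split=> //.
- split=> //; first by rewrite ltr01 ltr1n.
  have [C C0 HC] := L1; exists (C / delta); first by rewrite divr_gt0.
  move=> eps eps0; have [N1 HN1] := ln_sqr_le_powR eps0.
  exists (maxn N0 N1) => N N_gt0; rewrite geq_max => /andP[NN0 NN1].
  have NR : 0 < N%:R :> R by rewrite ltr0n.
  rewrite /moment; under eq_Rintegral do rewrite powRr1 ?normc_ge0//.
  apply: le_trans (HC N N_gt0) _; rewrite powRr1//.
  apply: le_trans (_ : C / delta * (N%:R `^ (eps - 1) * (delta * N%:R)) <= _); last first.
    by rewrite ler_wpM2l ?divr_ge0 ?(ltW C0) ?(ltW delta0)// ler_wpM2l ?powR_ge0// dens.
  have -> : C / delta * (N%:R `^ (eps - 1) * (delta * N%:R)) = C * (N%:R `^ (eps - 1) * N%:R).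
    by field; rewrite gt_eqF.
  by rewrite (mulrC (_ `^ _)) mulr_powRB1 ?(ltW NR)// ler_wpM2l ?(ltW C0)// HN1.
- move=> p /andP[p1 p2]; split=> //; first by rewrite (lt_trans ltr01 p1) p2.
  have [C C0 HC] := Lp p p1.
  have p0 : 0 < p by rewrite (lt_trans ltr01).
  (* By density, [N ^ (p - 1) = N ^ -1 * N ^ p] is at most [delta ^ - p * N ^ -1] times the [p]-th
     power of the counting function. *)
  exists (C / delta `^ p); first by rewrite divr_gt0// powR_gt0.
  exists N0 => N N_gt0 NN0.
  have NR : 0 < N%:R :> R by rewrite ltr0n.
  apply: le_trans (HC N N_gt0) _.
  apply: le_trans (_ : C / delta `^ p * (N%:R^-1 * (delta * N%:R) `^ p) <= _); last first.
    rewrite ler_wpM2l ?divr_ge0 ?powR_ge0 ?(ltW C0)// ler_wpM2l ?invr_ge0//.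
    by rewrite ge0_ler_powR ?nnegrE ?mulr_ge0 ?(ltW delta0) ?(ltW p0)// dens.
  have Np : N%:R `^ p = N%:R * N%:R `^ (p - 1) by rewrite mulr_powRB1.
  rewrite powRM ?(ltW delta0)// Np le_eqVlt; apply/orP; left; apply/eqP.
  by field; rewrite !gt_eqF// powR_gt0.
Qed.
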